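(* Let $V_{\mathbb{F}}$ be a $2$-dimensional $\mathbb{F}$-vector space with trivial $G_K$-action, where $k\subset\mathbb{F}$ and $k\neq\mathbb{F}_p$, and let $\mathcal{GR}^{\mathbf{v}}_{V_{\mathbb{F}},0}$ be the projective $\mathbb{F}$-scheme parameterising finite flat models of $V_{\mathbb{F}}$ with cyclotomic determinant. Let $\mathbb{F}'/\mathbb{F}$ be a finite extension. Suppose that $x_1,x_2\in\mathcal{GR}^{\mathbf{v}}_{V_{\mathbb{F}},0}(\mathbb{F}')$ and that the corresponding lattices $\mathfrak{M}_{\mathbb{F}',1}$ and $\mathfrak{M}_{\mathbb{F}',2}$ are both non-ordinary. Then (the images of) $x_1$ and $x_2$ lie on the same connected component of $\mathcal{GR}^{\mathbf{v}}_{V_{\mathbb{F}},0}$.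
   Context: Setting: $p>2$ is prime; $k$ is a finite field of cardinality $p^r$; $K_0=W(k)[1/p]$; $K/K_0$ is a totally ramified extension of degree $e$; $G_K$ is its absolute Galois group. $\mathbb{F}$ is a finite extension of $\mathbb{F}_p$ containing $k$, and $k\ne\mathbb{F}_p$ (so $r\ge 2$). $V_{\mathbb{F}}$ is a $2$-dimensional $\mathbb{F}$-vector space with trivial $G_K$-action, assumed to be the generic fibre of a finite flat group scheme; the mod $p$ cyclotomic character of $G_K$ is trivial, and in particular $(p-1)\mid e$. The étale $\phi$-module attached to $V_{\mathbb{F}}(-1)$ is $M_{\mathbb{F}}$: a free $(k\otimes_{\mathbb{F}_p}\mathbb{F})((u))$-module of rank $2$ with a map $\phi:M_{\mathbb{F}}\to M_{\mathbb{F}}$, semilinear over the endomorphism of $(k\otimes_{\mathbb{F}_p}\mathbb{F})((u))$ which is the $p$-power Frobenius on $k$, the identity on $\mathbb{F}$, and $u\mapsto u^p$, and having a basis $v_1,v_2$ with $\phi(v_1)=v_1$, $\phi(v_2)=v_2$. For $\mathbb{F}'/\mathbb{F}$ finite put $M_{\mathbb{F}'}=M_{\mathbb{F}}\otimes_{\mathbb{F}}\mathbb{F}'$. Write $k\otimes_{\mathbb{F}_p}\mathbb{F}'=\prod_{i=1}^r\mathbb{F}'$, the factors being indexed by the $r$ embeddings $\sigma_i$ of $k$, with idempotents $\epsilon_i$ numbered cyclically (indices mod $r$) so that $\phi$ maps $\epsilon_iM_{\mathbb{F}'}$ to $\epsilon_{i+1}M_{\mathbb{F}'}$. Points: $\mathcal{GR}^{\mathbf{v}}_{V_{\mathbb{F}},0}$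 is a projective $\mathbb{F}$-scheme, a closed subscheme of the affine Grassmannian of $(k\otimes_{\mathbb{F}_p}\mathbb{F})[[u]]$-lattices in $M_{\mathbb{F}}$. Its $\mathbb{F}'$-points, for $\mathbb{F}'/\mathbb{F}$ finite, are the free rank $2$ $(k\otimes_{\mathbb{F}_p}\mathbb{F}')[[u]]$-submodules $\mathfrak{M}\subset M_{\mathbb{F}'}$ spanning $M_{\mathbb{F}'}$ after inverting $u$, such that (a) $\phi(\mathfrak{M})\subset\mathfrak{M}$, and (b) for each $i$ the map $\phi:\epsilon_i\mathfrak{M}\to\epsilon_{i+1}\mathfrak{M}$ has, with respect to any choice of $\mathbb{F}'[[u]]$-bases, determinant $\alpha u^e$ with $\alpha\in\mathbb{F}'[[u]]^\times$. These points correspond to the finite flat models over $\mathcal{O}_K$ of $V_{\mathbb{F}}\otimes_{\mathbb{F}}\mathbb{F}'$ with cyclotomic determinant. Since connected components depend only on the underlying topological space, the scheme may be taken to be the reduced closed subscheme of the affine Grassmannian with these points. Ordinary: the lattice $\mathfrak{M}$ is ordinary if the corresponding finite flat group scheme is an extension of an étale by a multiplicative group scheme, each of rank one over $\mathbb{F}'$; equivalently, $\mathfrak{M}$ has a $\phi$-stable direct summand $\mathfrak{N}$, free of rank one over $(k\otimes_{\mathbb{F}_p}\mathbb{F}')[[u]]$, such that the image of $\phi$ on $\mathfrak{N}$ generates $\mathfrak{N}$ (equivalently, $\phi$ is not nilpotent on $\mathfrak{M}/u\mathfrak{M}$). Otherwise $\mathfrak{M}$ is non-ordinary. *)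

(* Defs.v *)
(* MathComp (algebra, field, multinomials), with the classical sets and
   topology of MathComp-Analysis. *)
From HB Require Import structures.
From mathcomp Require Import all_boot all_order all_fingroup all_algebra.
From mathcomp Require Import all_solvable all_field.
From mathcomp.multinomials Require Import mpoly.
From mathcomp Require Import boolp classical_sets functions cardinality fsbigop.
From mathcomp Require Import topology_structure connected.
From mathcomp Require Import zify.

Set Implicit Arguments.
Unset Strict Implicit.
Unset Printing Implicit Defensive.

Import Order.TTheory GRing.Theory Num.Theory.

Local Open Scope classical_set_scope.
Local Open Scope ring_scope.

(* The ring R((u)) of Laurent series; [laurent_mul] is the Cauchy product. *)
Record laurent (R : comPzRingType) := Laurent {
  lcoef :> int -> R;
  lcoef_bounded : exists N : int, forall n : int, n < N -> lcoef n = 0 }.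

HB.instance Definition _ R := gen_eqMixin (laurent R).
HB.instance Definition _ R := gen_choiceMixin (laurent R).

Section LaurentRing.
Variable R : comPzRingType.
Implicit Types (f g h : laurent R) (a b n : int).

Lemma laurentP f g : (forall n, f n = g n) <-> f = g.
Proof.
split=> [|-> //]; case: f g => [f bf] [g bg] /= /funext fg.
by rewrite fg in bf *; congr Laurent; exact: Prop_irrelevance.
Qed.

Fact laurent0_subproof :
  exists N : int, forall n : int, n < N -> (fun _ : int => 0 : R) n = 0.
Proof. by exists 0. Qed.
Definition laurent0 := Laurent laurent0_subproof.

Fact laurent_opp_subproof f :
  exists N : int, forall n : int, n < N -> (fun n => - f n) n = 0.
Proof. by have [N fN] := lcoef_bounded f; exists N => n /fN ->; rewrite oppr0. Qed.
Definition laurent_opp f := Laurent (laurent_opp_subproof f).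

Lemma lbound2 f g :
  exists N : int, forall n : int, n < N -> f n = 0 /\ g n = 0.
Proof.
have [a fa] := lcoef_bounded f; have [b gb] := lcoef_bounded g.
exists (Order.min a b) => n; rewrite lt_min => /andP[na nb].
by split; [exact: fa | exact: gb].
Qed.

Fact laurent_add_subproof f g :
  exists N : int, forall n : int, n < N -> (fun n => f n + g n) n = 0.
Proof.
have [N fgN] := lbound2 f g; exists N => n /fgN [-> ->]; exact: addr0.
Qed.
Definition laurent_add f g := Laurent (laurent_add_subproof f g).

Definition lconv f g n : R := \sum_(i \in [set: int]) f i * g (n - i).

(* The sum defining [lconv] has finite support. *)
Lemma lconvE f g a b n (N : nat) :
    (forall i : int, i < a -> f i = 0) -> (forall i : int, i < b -> g i = 0) ->
    n < a + b + N%:Z ->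
  lconv f g n = \sum_(j < N) f (a + j%:Z) * g (n - (a + j%:Z)).
Proof.
move=> fa gb nN.
pose F i := f i * g (n - i).
rewrite (fsbig_ord _ _ (fun j => F (a + j%:Z))).
rewrite -(@fsbig_image _ _ _ _ _ `I_N (fun j : nat => a + j%:Z) F); last first.
  by move=> i j _ _ /addrI /eqP; rewrite eqz_nat => /eqP.
apply/esym/fsbig_widen => // i [_ /= iN]; rewrite /F.
have [/fa ->|ai] := ltP i a; first by rewrite mul0r.
rewrite gb ?mulr0 //; apply: contra_notT iN; rewrite -leNgt => bni.
by exists (absz (i - a)%R); lia.
Qed.

Lemma lconv0 f g a b n :
    (forall i : int, i < a -> f i = 0) -> (forall i : int, i < b -> g i = 0) ->
  n < a + b -> lconv f g n = 0.
Proof.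
by move=> fa gb nab; rewrite (@lconvE f g a b n 0) ?big_ord0 // addr0.
Qed.

Fact laurent_mul_subproof f g :
  exists N : int, forall n : int, n < N -> lconv f g n = 0.
Proof.
have [a fa] := lcoef_bounded f; have [b gb] := lcoef_bounded g.
by exists (a + b) => n; exact: lconv0.
Qed.
Definition laurent_mul f g := Laurent (laurent_mul_subproof f g).

Fact monomial_subproof (n : int) :
  exists N : int, forall m : int, m < N -> (fun m => (m == n)%:R : R) m = 0.
Proof. by exists n => m mn; rewrite lt_eqF. Qed.
(* u ^ n *)
Definition lmonomial n := Laurent (monomial_subproof n).

Fact laurent_addA : associative laurent_add.
Proof. by move=> f g h; apply/laurentP => n; rewrite /= addrA. Qed.
Fact laurent_addC : commutative laurent_add.
Proof. by move=> f g; apply/laurentP => n; rewrite /= addrC. Qed.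
Fact laurent_add0 : left_id laurent0 laurent_add.
Proof. by move=> f; apply/laurentP => n; rewrite /= add0r. Qed.
Fact laurent_addN : left_inverse laurent0 laurent_opp laurent_add.
Proof. by move=> f; apply/laurentP => n; rewrite /= addNr. Qed.

HB.instance Definition _ := GRing.isZmodule.Build (laurent R)
  laurent_addA laurent_addC laurent_add0 laurent_addN.

Fact lconvC f g n : lconv f g n = lconv g f n.
Proof.
have [a fa] := lcoef_bounded f; have [b gb] := lcoef_bounded g.
have [nab|nab] := ltP n (a + b).
  by rewrite (lconv0 fa gb) // (lconv0 gb fa) // addrC.
have [N nE] : exists N : nat, n = a + b + N%:Z by exists (absz (n - (a + b))%R); lia.
rewrite (@lconvE f g a b n N.+1) //; last lia.
rewrite (@lconvE g f b a n N.+1) //; last lia.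
rewrite (reindex_inj rev_ord_inj); apply: eq_bigr => j _ /=.
have jN := ltn_ord j; rewrite mulrC; congr (g _ * f _); lia.
Qed.

Fact laurent_mulC : commutative laurent_mul.
Proof. by move=> f g; apply/laurentP => n; exact: lconvC. Qed.

Fact laurent_mulA : associative laurent_mul.
Proof.
move=> f g h; apply/laurentP => n; rewrite /= (lconvC _ h).
have [a fa] := lcoef_bounded f; have [b gb] := lcoef_bounded g.
have [c hc] := lcoef_bounded h.
have [N nN] : exists N : nat, n < a + b + c + N%:Z.
  by exists (absz (n - (a + b + c))%R).+1; lia.
rewrite (@lconvE f (laurent_mul g h) a (b + c) n N) //; first last.
- by rewrite addrA.
- by move=> i ?; exact: lconv0 gb hc _.
rewrite (@lconvE h (laurent_mul f g) c (a + b) n N) //; first last.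
- by rewrite (addrC c).
- by move=> i ?; exact: lconv0 fa gb _.
under eq_bigr => i _.
  rewrite /= lconvC (@lconvE h g c b _ N) //; last by have := ltn_ord i; lia.
  rewrite mulr_sumr; over.
under [RHS]eq_bigr => i _.
  rewrite /= (@lconvE f g a b _ N) //; last by have := ltn_ord i; lia.
  rewrite mulr_sumr; over.
rewrite exchange_big /=; apply: eq_bigr => i _; apply: eq_bigr => j _.
rewrite !mulrA [f _ * h _]mulrC; congr (_ * _ * g _); lia.
Qed.

Fact laurent_mul1 : left_id (lmonomial 0) laurent_mul.
Proof.
move=> f; apply/laurentP => n /=; have [a fa] := lcoef_bounded f.
have [N nN] : exists N : nat, n < 0 + a + N.+1%:Z by exists (absz (n - a)%R); lia.
rewrite (@lconvE _ f 0 a n N.+1) //; last by move=> i i0 /=; rewrite lt_eqF.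
rewrite big_ord_recl /= big1 ?addr0 ?eqxx ?mul1r ?subr0 // => j _.
by rewrite add0r /= mul0r.
Qed.

Fact laurent_mulD : left_distributive laurent_mul +%R.
Proof.
move=> f g h; apply/laurentP => n /=.
have [a fga] := lbound2 f g; have [b hb] := lcoef_bounded h.
have fa i : i < a -> f i = 0 by move=> /fga[].
have ga i : i < a -> g i = 0 by move=> /fga[].
have sa i : i < a -> laurent_add f g i = 0 by move=> /fga[/= -> ->]; rewrite addr0.
have [N nN] : exists N : nat, n < a + b + N%:Z by exists (absz (n - (a + b))%R).+1; lia.
rewrite (@lconvE _ h a b n N) // (@lconvE f h a b n N) // (@lconvE g h a b n N) //.
by rewrite -big_split; apply: eq_bigr => j _ /=; rewrite mulrDl.
Qed.

HB.instance Definition _ := GRing.Zmodule_isComPzRing.Build (laurent R)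
  laurent_mulA laurent_mulC laurent_mul1 laurent_mulD.

End LaurentRing.

Section LaurentMaps.
Variables (R S : comPzRingType) (s : {rmorphism R -> S}).

Fact laurent_map_subproof (f : laurent R) :
  exists N : int, forall n : int, n < N -> s (f n) = 0.
Proof. by have [N fN] := lcoef_bounded f; exists N => n /fN ->; rewrite rmorph0. Qed.
Definition laurent_map f := Laurent (laurent_map_subproof f).

Fact laurent_map_is_zmod : zmod_morphism laurent_map.
Proof. by move=> f g; apply/laurentP => n /=; rewrite rmorphB. Qed.
HB.instance Definition _ :=
  GRing.isZmodMorphism.Build (laurent R) (laurent S) laurent_map
    laurent_map_is_zmod.

Fact laurent_map_is_monoid : monoid_morphism laurent_map.
Proof.
split; first by apply/laurentP => n /=; rewrite rmorph_nat.
move=> f g; apply/laurentP => n /=.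
have [a fa] := lcoef_bounded f; have [b gb] := lcoef_bounded g.
have [N nN] : exists N : nat, n < a + b + N%:Z by exists (absz (n - (a + b))%R).+1; lia.
rewrite (lconvE fa gb nN) (@lconvE _ _ _ a b n N) //.
- by rewrite rmorph_sum; apply: eq_bigr => j _; rewrite rmorphM.
- by move=> i /fa /= ->; rewrite rmorph0.
- by move=> i /gb /= ->; rewrite rmorph0.
Qed.
HB.instance Definition _ :=
  GRing.isMonoidMorphism.Build (laurent R) (laurent S) laurent_map
    laurent_map_is_monoid.

End LaurentMaps.

Section LaurentPower.
Variables (R : comPzRingType) (p : nat).
Implicit Types f g : laurent R.

Fact laurent_subst_subproof f : exists N : int, forall n : int, n < N ->
  (if (p%:Z %| n)%Z then f (n %/ p%:Z)%Z else 0) = 0.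
Proof.
have [N fN] := lcoef_bounded f; exists (Order.min 0 (p%:Z * N)) => n nN.
case: ifP => // /dvdzP [q nq]; apply: fN.
have p0 : p <> 0%N by move=> p0; move: nN; rewrite nq p0; lia.
rewrite nq mulzK; last lia.
by nia.
Qed.
(* f(u) |-> f(u^p) *)
Definition laurent_subst f := Laurent (laurent_subst_subproof f).

Fact laurent_subst_is_zmod : zmod_morphism laurent_subst.
Proof.
by move=> f g; apply/laurentP => n /=; case: ifP => //; rewrite oppr0 addr0.
Qed.
HB.instance Definition _ :=
  GRing.isZmodMorphism.Build (laurent R) (laurent R) laurent_subst
    laurent_subst_is_zmod.

Hypothesis p_gt0 : (0 < p)%N.

Lemma laurent_subst1 : laurent_subst 1 = 1.
Proof.
apply/laurentP => n /=; case: ifP => [/dvdzP [q ->]|pn].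
  rewrite mulzK; last lia.
  by congr (nat_of_bool _)%:R; lia.
by case: eqP pn => // ->; rewrite dvdz0.
Qed.

Lemma laurent_substM f g :
  laurent_subst (f * g) = laurent_subst f * laurent_subst g.
Proof.
apply/laurentP => n /=.
have p0 : p%:Z != 0 by lia.
pose F i := laurent_subst f i * laurent_subst g (n - i).
transitivity (\sum_(i \in [set: int]) F (p%:Z * i)); last first.
  rewrite -(@fsbig_image _ _ _ _ _ setT (fun i => p%:Z * i) F); last first.
    by move=> i j _ _; exact: mulfI.
  apply: fsbig_widen => // i [_ /= ni]; rewrite /F /=.
  case: ifP => [/dvdzP [q iq]|]; last by rewrite mul0r.
  by case: ni; exists q; rewrite // mulrC.
rewrite /F /=; case: ifP => [/dvdzP [q ->]|pn].
  rewrite mulzK //; apply: eq_fsbigr => i _.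
  rewrite dvdz_mulr ?dvdzz // [p%:Z * i]mulrC -mulrBl dvdz_mull ?dvdzz //.
  by rewrite !mulzK.
rewrite fsbig1 // => i _.
by rewrite rpredBr ?dvdz_mulr ?dvdzz //= pn mulr0.
Qed.

End LaurentPower.

(* [k] has [p ^ r] elements. The [r] embeddings of [k] into an extension [E] are
   numbered so that sigma_(i-1) = sigma_i o Frob (indices mod [r]);
   [embedding_unitmx] is the bijectivity of
   k (x)_{F_p} E -> E ^ r, x (x) y |-> (sigma_i(x) y)_i. *)
Section Embeddings.
Variables (p r : nat) (k : finFieldType) (E : fieldType).
Variable iota : {rmorphism k -> E}.
Hypotheses (p_prime : prime p) (card_k : #|k| = (p ^ r)%N).

Definition embedding (i : 'I_r) (x : k) : E := iota (x ^+ (p ^ (r - i))).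

Fact embedding_is_zmod i : zmod_morphism (embedding i).
Proof.
have kp : p \in [pchar k] by rewrite (card_finPcharP (n := r)).
have kpn : [pchar k].-nat (p ^ (r - i))%N by rewrite pnatX pnatE ?kp.
move=> x y; rewrite /embedding -rmorphB; congr (iota _).
by rewrite exprDn_pchar // exprNn_pchar.
Qed.

Fact embedding_is_monoid i : monoid_morphism (embedding i).
Proof.
by split=> [|x y]; rewrite /embedding ?expr1n ?rmorph1 // exprMn rmorphM.
Qed.

Lemma embedding_frob i x : embedding (ord_pred i) x = embedding i (x ^+ p).
Proof.
rewrite /embedding -exprM -expnS; congr (iota _).
have ir := ltn_ord i; rewrite /=.
case: (posnP i) => [i0|i_gt0].
  rewrite i0 add0n modn_small ?subn0; last lia.
  by rewrite (_ : r - r.-1 = 1)%N ?expn1 1?expnSr ?exprM -?card_k ?expf_card //; lia.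
rewrite (_ : (i + r).-1 = (i.-1 + r))%N; last lia.
rewrite modnDr modn_small; last lia.
by congr (_ ^+ (_ ^ _)); lia.
Qed.

Lemma embedding_unitmx :
  exists y : 'I_r -> k, \matrix_(l, i) embedding i (y l) \in unitmx.
Proof.
have /cyclicP[g gE] := field_unit_group_cyclic [set: {unit k}]%G.
have ordg : #[g]%g = (p ^ r).-1 by rewrite /order -gE card_finField_unit card_k.
exists (fun l => val g ^+ l).
pose a : 'rV[E]_r := \row_i embedding i (val g).
have -> : \matrix_(l, i) embedding i (val g ^+ l) = Vandermonde r a.
  by apply/matrixP => l i; rewrite !mxE /embedding exprAC rmorphXn.
rewrite unitmxE unitfE det_Vandermonde; apply/prodf_neq0 => i _.
apply/prodf_neq0 => j ij; rewrite !mxE subr_eq0; apply/eqP => /fmorph_inj.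
have p1 := prime_gt1 p_prime; have jr := ltn_ord j.
move=> /eqP; rewrite -!FinRing.val_unitX (inj_eq val_inj) eq_expg_mod_order ordg.
have le1 : (p ^ (r - j) < p ^ (r - i))%N by rewrite ltn_exp2l //; lia.
have le2 : (p ^ (r - i) <= p ^ r)%N by rewrite leq_exp2l //; lia.
have le3 : (1 < p ^ (r - j))%N by rewrite -(exp1n (r - j)) ltn_exp2r //; lia.
rewrite eq_sym eqn_mod_dvd ?(ltnW le1) // => /dvdnP.
move: le1 le2 le3; move: (p ^ (r - i))%N (p ^ (r - j))%N (p ^ r)%N => A B P.
by move=> AB AP B1 [[|q]]; rewrite ?mul0n ?mulSn; [lia | move: (q * _)%N; lia].
Qed.

End Embeddings.

(* k (x)_{F_p} E, written as the product of its factors E indexed by the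
   embeddings above. The endomorphism Frob (x) id is [tens_frob]: it sends
   sigma_i(x) y to sigma_i(x ^ p) y = sigma_(i-1)(x) y. In particular it maps
   the factor [i] to the factor [ordS i] (lemma [tens_frobE]). *)
Definition tens (r : nat) (E : comPzRingType) : Type := {ffun 'I_r -> E}.

Section Tens.
Variables (r : nat) (E : comPzRingType).

HB.instance Definition _ := GRing.Zmodule.on (tens r E).
HB.instance Definition _ := GRing.Zmodule_isPzRing.Build (tens r E)
  (@ffun_mulA 'I_r E) (@ffun_mul_1l 'I_r E) (@ffun_mul_1r 'I_r E)
  (@ffun_mul_addl 'I_r E) (@ffun_mul_addr 'I_r E).
HB.instance Definition _ := GRing.PzRing_hasCommutativeMul.Build (tens r E)
  (@ffun_mulC 'I_r E).

Definition tens_proj (i : 'I_r) (a : tens r E) : E := a i.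

Fact tens_proj_is_zmod i : zmod_morphism (tens_proj i).
Proof. by move=> a b; rewrite /tens_proj !ffunE. Qed.
HB.instance Definition _ i :=
  GRing.isZmodMorphism.Build (tens r E) E (tens_proj i) (tens_proj_is_zmod i).
Fact tens_proj_is_monoid i : monoid_morphism (tens_proj i).
Proof. by split=> [|a b]; rewrite /tens_proj !ffunE. Qed.
HB.instance Definition _ i :=
  GRing.isMonoidMorphism.Build (tens r E) E (tens_proj i) (tens_proj_is_monoid i).

Definition tens_frob (a : tens r E) : tens r E := [ffun i => a (ord_pred i)].

Fact tens_frob_is_zmod : zmod_morphism tens_frob.
Proof. by move=> a b; apply/ffunP => i; rewrite !ffunE. Qed.
HB.instance Definition _ :=
  GRing.isZmodMorphism.Build (tens r E) (tens r E) tens_frob tens_frob_is_zmod.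
Fact tens_frob_is_monoid : monoid_morphism tens_frob.
Proof. by split=> [|a b]; apply/ffunP => i; rewrite !ffunE. Qed.
HB.instance Definition _ :=
  GRing.isMonoidMorphism.Build (tens r E) (tens r E) tens_frob
    tens_frob_is_monoid.

Lemma tens_frobE a i : tens_frob a (ordS i) = a i.
Proof. by rewrite ffunE ordSK. Qed.

End Tens.

Section PowerSeries.
Variable R : comPzRingType.

Definition power_series (f : laurent R) : Prop :=
  forall n : int, n < 0 -> f n = 0.

Definition power_series_mx m n (A : 'M[laurent R]_(m, n)) : Prop :=
  forall i j, power_series (A i j).

Definition power_series_unit (f : laurent R) : Prop :=
  power_series f /\ exists2 g, power_series g & f * g = 1.

(* R[[u]]-submodules of R((u))^2 *)
Definition submodule (P : set 'rV[laurent R]_2) : Prop :=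
  [/\ P 0,
      forall x y, P x -> P y -> P (x + y)
    & forall a x, power_series a -> P x -> P (a *: x)].

(* The rows of [B] are a basis of the R[[u]]-module [P], so that [P] is free of
   rank [n]. *)
Definition is_basis n (P : set 'rV[laurent R]_2) (B : 'M[laurent R]_(n, 2)) :
  Prop :=
  P = [set c *m B | c in [set c : 'rV_n | power_series_mx c]] /\
  (forall c : 'rV_n, power_series_mx c -> c *m B = 0 -> c = 0).

Definition free_of_rank n (P : set 'rV[laurent R]_2) : Prop :=
  exists B : 'M[laurent R]_(n, 2), is_basis P B.

End PowerSeries.

(* M_E, in coordinates with respect to the basis v_1, v_2 fixed by phi: row
   vectors of length 2 over (k (x) E)((u)). *)
Notation etale_module r E := 'rV[laurent (tens r E)]_2.

Section Lattices.
Variables (p r e : nat) (E : comPzRingType).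
Implicit Types M N : set (etale_module r E).

Definition phi (x : etale_module r E) : etale_module r E :=
  map_mx (fun f => laurent_subst p (laurent_map (@tens_frob r E) f)) x.

Lemma phi_basis (l : 'I_2) : (0 < p)%N -> phi (delta_mx 0 l) = delta_mx 0 l.
Proof.
move=> p0; apply/rowP => i; rewrite !mxE rmorph_nat.
by case: (_ && _); rewrite ?laurent_subst1 ?(raddf0 (laurent_subst p)).
Qed.

(* The idempotent component epsilon_i M, inside E((u))^2 *)
Definition component (i : 'I_r) M : set 'rV[laurent E]_2 :=
  [set map_mx (laurent_map (@tens_proj r E i)) x | x in M].

(* [B] and [B'] are bases of epsilon_i M and epsilon_(i+1) M, and [C] is the
   matrix of phi : epsilon_i M -> epsilon_(i+1) M with respect to them. On
   components phi is [laurent_subst p], by [tens_frobE]. *)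
Definition frob_det M : Prop :=
  forall (i : 'I_r) (B B' C : 'M[laurent E]_2),
    is_basis (component i M) B -> is_basis (component (ordS i) M) B' ->
    power_series_mx C -> map_mx (laurent_subst p) B = C *m B' ->
    exists2 alpha, power_series_unit alpha
      & \det C = alpha * lmonomial E e%:Z.

Definition gr_lattice M : Prop :=
  [/\ free_of_rank 2 M,
      forall x, exists n : nat, M (lmonomial (tens r E) n%:Z *: x),
      forall x, M x -> M (phi x)
    & frob_det M].

(* [N] is a phi-stable direct summand, free of rank one, and generated by
   phi(N). *)
Definition ordinary M : Prop :=
  exists N N',
    [/\ free_of_rank 1 N, submodule N',
        M = [set x + y | x in N & y in N'] /\ N `&` N' = [set 0],
        forall x, N x -> N (phi x)
      & smallest (@submodule (tens r E)) (phi @` N) = N].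

End Lattices.

Section Order.
Variable R : comPzRingType.
Implicit Types (f g : laurent R) (a b n : int).

Definition order_ge a (m n : nat) (A : 'M[laurent R]_(m, n)) : Prop :=
  forall i j (t : int), t < a -> A i j t = 0.

Lemma laurent_sumE (I : Type) (s : seq I) (P : pred I) (F : I -> laurent R) n :
  (\sum_(i <- s | P i) F i) n = \sum_(i <- s | P i) F i n.
Proof. by elim/big_rec2: _ => //= i x y _ <-. Qed.

Lemma monomialM a f n : (lmonomial R a * f) n = f (n - a).
Proof.
have [b fb] := lcoef_bounded f.
have [N nN] : exists N : nat, n < a + b + N.+1%:Z.
  by exists (absz (n - (a + b))%R); lia.
have ma i : i < a -> lmonomial R a i = 0 by move=> ia /=; rewrite lt_eqF.
rewrite -[LHS]/(lconv _ _ _) (lconvE ma fb nN) big_ord_recl big1 ?addr0.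
  by rewrite /= ?addr0 eqxx mul1r.
move=> j _ /=; rewrite (_ : (_ == _) = false) ?mul0r //.
by rewrite /bump /=; lia.
Qed.

Lemma order_geM (m n l : nat) a b (A : 'M[laurent R]_(m, n)) (B : 'M[laurent R]_(n, l)) :
  order_ge a A -> order_ge b B -> order_ge (a + b) (A *m B).
Proof.
move=> Aa Bb i j t tab; rewrite mxE laurent_sumE big1 // => k _.
exact: (lconv0 (Aa i k) (Bb k j)).
Qed.

Lemma order_ge_exists (m n : nat) (A : 'M[laurent R]_(m, n)) :
  exists a : nat, order_ge (- a%:Z) A.
Proof.
have /choice[N NP] : forall ij : 'I_m * 'I_n, exists N : nat,
    forall t : int, t < - N%:Z -> A ij.1 ij.2 t = 0.
  move=> ij; have [N AN] := lcoef_bounded (A ij.1 ij.2).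
  by exists (absz N) => t tN; apply: AN; lia.
exists (\max_ij N ij)%N => i j t tN; apply: (NP (i, j)).
by have := leq_bigmax (F := N) (i, j); lia.
Qed.

Lemma order_ge_det (n : nat) (A : 'M[laurent R]_n) : order_ge 0 A -> power_series (\det A).
Proof.
move=> A0 t t0; rewrite laurent_sumE big1 // => s _.
suff H : power_series ((-1) ^+ odd_perm s * \prod_i A i (s i)) by exact: H.
have H1 : power_series (1 : laurent R) by move=> u u0 /=; rewrite lt_eqF.
have HM f g : power_series f -> power_series g -> power_series (f * g).
  by move=> f0 g0 u u0; apply: (lconv0 f0 g0).
apply: (HM); last first.
  by apply: big_ind; [exact: H1 | exact: HM | move=> i _ u u0; exact: A0].
have HN f : power_series f -> power_series (- f).
  by move=> f0 u /f0 /= ->; rewrite oppr0.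
by case: odd_perm; rewrite ?expr1 ?expr0 //; exact: HN.
Qed.

Lemma order_ge_adj (n : nat) (A : 'M[laurent R]_n) : order_ge 0 A -> order_ge 0 (\adj A).
Proof.
move=> A0 i j; rewrite mxE /cofactor.
have D : power_series (\det (row' j (col' i A))).
  by apply: order_ge_det => ? ? t t0; rewrite !mxE; exact: A0.
move=> t t0; rewrite -signr_odd; case: odd; rewrite ?expr1 ?expr0 ?mulN1r ?mul1r /=.
  by rewrite D ?oppr0.
exact: D.
Qed.

Lemma map_mx_substM p (m n l : nat) (A : 'M[laurent R]_(m, n))
    (B : 'M[laurent R]_(n, l)) : (0 < p)%N ->
  map_mx (laurent_subst p) (A *m B) =
  map_mx (laurent_subst p) A *m map_mx (laurent_subst p) B.
Proof.
move=> p0; apply/matrixP => i j; rewrite !mxE (raddf_sum (laurent_subst p)).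
by apply: eq_bigr => k _; rewrite !mxE -laurent_substM.
Qed.

End Order.

Section Window.
Variables (p r e : nat) (E : comPzRingType) (M : set (etale_module r E)).
Hypotheses (p_gt1 : (1 < p)%N) (latM : gr_lattice p e M).

(* u^e M_0 <= M <= M_0 for every such lattice M, where M_0 is the lattice spanned
   by v_1, v_2; this is [gr_lattice_integral] and [gr_lattice_window]. *)
Lemma gr_lattice_integral x : M x -> power_series_mx x.
Proof.
have [[B [MB _]] _ phiM _] := latM.
have [a Ba] := order_ge_exists B.
have {Ba} Ma y : M y -> order_ge (- a%:Z) y.
  rewrite MB => -[c c0 <-]; rewrite -[- _]add0r; exact: order_geM.
have {a Ma} : forall y, M y -> order_ge (- 0%:Z) y.
  elim: a Ma => // a IH Ma; apply: IH => y My i l n na.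
  apply/ffunP => s; have := Ma _ (phiM _ My) i l (p%:Z * n).
  rewrite !mxE /= dvdz_mulr ?dvdzz // mulrC mulzK; last lia.
  move=> /(_ _)/ffunP/(_ (ordS s)); rewrite tens_frobE => -> //; first by rewrite !ffunE.
  by nia.
by move=> M0 /M0; rewrite oppr0.
Qed.

Let diag_sub (c : laurent E) : exists N : int, forall n : int, n < N ->
  ([ffun=> c n] : tens r E) = 0.
Proof.
by have [N cN] := lcoef_bounded c; exists N => n nN; apply/ffunP => i; rewrite !ffunE cN.
Qed.
Let diag c := Laurent (diag_sub c).

Let pr (i : 'I_r) := laurent_map (@tens_proj r E i).

Let diagK i c : pr i (diag c) = c.
Proof. by apply/laurentP => n; rewrite /= /tens_proj ffunE. Qed.

Let pr_order (i : 'I_r) (a : int) (m n : nat) (A : 'M[laurent (tens r E)]_(m, n)) :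
  order_ge a A -> order_ge a (map_mx (pr i) A).
Proof. by move=> Aa k l t ta; rewrite mxE /= /tens_proj Aa ?ffunE. Qed.

Lemma component_basis (i : 'I_r) (B D : 'M[laurent (tens r E)]_2) : is_basis M B -> B *m D = 1%:M ->
  is_basis (component i M) (map_mx (pr i) B).
Proof.
move=> [MB _] BD; split; last first.
  move=> c _ /(congr1 (mulmx^~ (map_mx (pr i) D))).
  by rewrite mul0mx -mulmxA -map_mxM BD map_mx1 mulmx1.
rewrite /component MB predeqE => y; split=> [[_ [c c0 <-] <-]|[c c0 <-]].
  exists (map_mx (pr i) c); last by rewrite -map_mxM.
  exact: pr_order.
exists (map_mx diag c *m B); last first.
  rewrite map_mxM -map_mx_comp; congr (_ *m _).
  by apply/matrixP => k l; rewrite !mxE; exact: diagK.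
exists (map_mx diag c) => // k l t t0; rewrite mxE /=.
by apply/ffunP => s; rewrite !ffunE c0.
Qed.

Lemma gr_lattice_window x : power_series_mx x -> M (lmonomial _ e%:Z *: x).
Proof.
have [[B BM] spanM phiM detM] := latM; have [MB _] := BM.
have p_gt0 : (0 < p)%N by lia.
have [t tM] : exists t : nat, forall l, M (lmonomial _ t%:Z *: delta_mx 0 l).
  have /choice[t tM] := fun l : 'I_2 => spanM (delta_mx 0 l).
  exists (\max_l t l)%N => l; have : (t l <= \max_l t l)%N by exact: leq_bigmax.
  move: (\max_l t l)%N => m tlm; have := tM l; rewrite MB => -[c c0 cB].
  pose k := (m - t l)%N.
  exists (lmonomial _ k%:Z *: c).
    by move=> i m' n n0; rewrite mxE monomialM c0 //; lia.
  rewrite -scalemxAl cB scalerA; congr (_ *: _); apply/laurentP => n.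
  by rewrite monomialM /= /k; congr (nat_of_bool _)%:R; lia.
have [D0 D0B] : exists D0 : 'M_2, D0 *m B = (lmonomial (tens r E) t%:Z)%:M.
  have /choice[d dB] : forall l, exists d : 'rV_2,
      d *m B = lmonomial _ t%:Z *: delta_mx 0 l.
    by move=> l; have := tM l; rewrite MB => -[d _ dB]; exists d.
  exists (\matrix_l d l); apply/row_matrixP => l.
  by rewrite row_mul rowK dB rowE -scalemx1 -scalemxAr mulmx1.
pose D := lmonomial (tens r E) (- t%:Z) *: D0.
have DB : D *m B = 1%:M.
  rewrite -scalemxAl D0B scale_scalar_mx; congr (_%:M); apply/laurentP => n.
  by rewrite monomialM /=; congr (nat_of_bool _)%:R; lia.
have BD := mulmx1C DB.
have [C C0 CB] : exists2 C : 'M_2, power_series_mx C &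
    map_mx (fun f => laurent_subst p (laurent_map (@tens_frob r E) f)) B = C *m B.
  have /choice[c cB] : forall l, exists c : 'rV_2, power_series_mx c /\
      c *m B = phi p (row l B).
    move=> l; have : M (phi p (row l B)).
      apply: phiM; rewrite MB; exists (delta_mx 0 l); last by rewrite rowE.
      by move=> ? ? n n0; rewrite mxE /=; case: (_ && _); rewrite //= lt_eqF.
    by rewrite MB => -[c c0 cB]; exists c.
  exists (\matrix_l c l).
    by move=> l m n n0; rewrite mxE; exact: (cB l).1.
  by apply/row_matrixP => l; rewrite row_mul rowK (cB l).2; apply/rowP => m; rewrite !mxE.
have [a Da] : exists a : nat, order_ge (- a%:Z) D := order_ge_exists D.
have {a Da} De : order_ge (- e%:Z) D.
  have [ae|ae] := leqP a e; first by move=> i l n ne; apply: Da; lia.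
  have [b aE] : exists b : nat, a = (e + b)%N by exists (a - e)%N; lia.
  elim: b a {ae} aE Da => [|b IH] a aE Da; first by rewrite aE addn0 in Da.
  apply: (IH _ erefl) => k l n na; apply/ffunP => i; rewrite ffunE.
  have Bi := component_basis i BM BD.
  have Bi' := component_basis (ordS i) BM BD.
  have Ci0 : power_series_mx (map_mx (pr (ordS i)) C) by exact: pr_order.
  have CBi : map_mx (laurent_subst p) (map_mx (pr i) B) =
      map_mx (pr (ordS i)) C *m map_mx (pr (ordS i)) B.
    rewrite -map_mxM -CB; apply/matrixP => s s'; rewrite !mxE.
    apply/laurentP => m /=; case: ifP; rewrite ?raddf0 // => _.
    by rewrite /tens_proj tens_frobE.
  have [al [al0 [be be0 albe]] detC] := detM _ _ _ _ Bi Bi' Ci0 CBi.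
  set Ci := map_mx _ C in Ci0 CBi detC; set Di := map_mx (pr (ordS i)) D.
  have substDB : map_mx (laurent_subst p) (map_mx (pr i) D) *m
      map_mx (laurent_subst p) (map_mx (pr i) B) = 1%:M.
    rewrite -map_mx_substM // -map_mxM DB map_mx1; apply/matrixP => s s'.
    by rewrite !mxE; case: (_ == _); rewrite ?laurent_subst1 ?(raddf0 (laurent_subst p)).
  have DC : map_mx (laurent_subst p) (map_mx (pr i) D) *m Ci = Di.
    rewrite -[LHS]mulmx1 -(map_mx1 (pr (ordS i))) -BD map_mxM mulmxA.
    by rewrite -(mulmxA _ Ci) -CBi substDB mul1mx.
  have H1 : order_ge (- a%:Z + 0) (Di *m \adj Ci).
    by apply: order_geM; [exact: pr_order | exact: order_ge_adj].
  have := congr1 (fun X => be *: (X *m \adj Ci)) DC.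
  rewrite -mulmxA mul_mx_adj detC mul_mx_scalar scalerA mulrA [be * _]mulrC albe mul1r.
  move: (Di *m _) H1 => X H1 /matrixP/(_ k l).
  rewrite !mxE => /(congr1 (fun f : laurent E => f (p%:Z * n + e%:Z))).
  rewrite monomialM addrK /= dvdz_mulr ?dvdzz // mulrC mulzK; last lia.
  rewrite /tens_proj => ->.
  by apply: (lconv0 be0 (H1 k l)); nia.
move=> x0; rewrite MB; exists ((lmonomial _ e%:Z *: x) *m D); last first.
  by rewrite -mulmxA DB mulmx1.
have : order_ge (e%:Z - e%:Z) ((lmonomial _ e%:Z *: x) *m D).
  apply: order_geM => // i l n ne.
  by rewrite mxE monomialM x0 //; lia.
by rewrite subrr.
Qed.

End Window.

(* The topological space underlying Proj F[X_0, ..., X_(n-1)] = P^(n-1)_F: the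
   homogeneous prime ideals that do not contain the irrelevant ideal, with the
   Zariski topology. [proj_homog] says that the ideal contains the homogeneous
   components of its elements. *)
Section Proj.
Variables (n : nat) (F : fieldType).

Record proj : Type := Proj {
  proj_ideal :> set {mpoly F[n]};
  proj0 : proj_ideal 0;
  projD : forall f g, proj_ideal f -> proj_ideal g -> proj_ideal (f + g);
  projMl : forall f g, proj_ideal g -> proj_ideal (f * g);
  proj_prime : forall f g, proj_ideal (f * g) -> proj_ideal f \/ proj_ideal g;
  proj_homog : forall f d, proj_ideal f -> proj_ideal (pihomog mdeg d f);
  proj_relevant : exists i : 'I_n, ~ proj_ideal 'X_i }.

HB.instance Definition _ := gen_eqMixin proj.
HB.instance Definition _ := gen_choiceMixin proj.

Definition zariski_open (U : set proj) : Prop :=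
  exists I : set {mpoly F[n]}, U = [set x : proj | ~ I `<=` x].

Lemma zariski_openP U :
  zariski_open U <->
  forall x, U x -> exists2 f, ~ proj_ideal x f &
    forall y : proj, ~ proj_ideal y f -> U y.
Proof.
split=> [[I ->] x /existsNP[f /not_implyP[If xf]]|UP].
  by exists f => // y yf /(_ f If).
exists [set f | forall y : proj, ~ proj_ideal y f -> U y].
rewrite predeqE => x; split=> [/UP[f xf fU] /(_ f fU)//|].
by move=> /existsNP[f /not_implyP[fU xf]]; exact: fU.
Qed.

Fact zariski_openT : zariski_open setT.
Proof.
apply/zariski_openP => x _; have [i xi] := proj_relevant x.
by exists 'X_i.
Qed.

Fact zariski_openI : setI_closed zariski_open.
Proof.
move=> U V /zariski_openP UP /zariski_openP VP; apply/zariski_openP.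
move=> x [/UP[f xf fU] /VP[g xg gV]]; exists (f * g).
  by case/proj_prime.
move=> y yfg; split; [apply: fU|apply: gV] => yf; apply: yfg.
  by rewrite mulrC; exact: projMl.
exact: projMl.
Qed.

Fact zariski_open_bigU (I : Type) (f : I -> set proj) :
  (forall i, zariski_open (f i)) -> zariski_open (\bigcup_i f i).
Proof.
move=> fP; apply/zariski_openP => x [i _ /(proj1 (zariski_openP _) (fP i))[g xg gf]].
by exists g => // y /gf ?; exists i.
Qed.

HB.instance Definition _ := isOpenTopological.Build proj
  zariski_openT zariski_openI zariski_open_bigU.

End Proj.

(* The image in |P^(n-1)_F| of the F'-point with homogeneous coordinates [a] *)
Section ProjPoint.
Variables (n : nat) (F F' : fieldType) (j : {rmorphism F -> F'}).
Variable a : 'I_n -> F'.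

Definition vanishing_ideal : set {mpoly F[n]} :=
  [set f | forall d, (map_mpoly j (pihomog mdeg d f)).@[a] = 0].

(* f |-> f(t a), a polynomial in t *)
Let cone := mmap (polyC \o j) (fun i => a i *: 'X : {poly F'}).

Let coneE f d : (cone f)`_d = (map_mpoly j (pihomog mdeg d f)).@[a].
Proof.
have -> : (cone f)`_d =
    \sum_(m <- msupp f) (j f@_m * \prod_(i < n) a i ^+ m i) *+ (mdeg m == d).
  rewrite /cone /mmap coef_sum; apply: eq_bigr => m _.
  rewrite coefCM /mmap1; under eq_bigr do rewrite exprZn.
  rewrite scaler_prod prodrXr -mdegE coefZ coefXn eq_sym mulrA.
  by rewrite mulr_natr.
rewrite pihomogE (raddf_sum (map_mpoly j)) (raddf_sum (meval a)) [RHS]big_mkcond; apply: eq_bigr => m _ /=.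
case: ifP => _; rewrite ?mulr0n // mulr1n.
by rewrite map_mpolyZ map_mpolyX mevalZ mevalX.
Qed.

Let vanishingE f : vanishing_ideal f <-> cone f = 0.
Proof.
split=> [f0|f0 d]; last by rewrite -coneE f0 coef0.
by apply/polyP => d; rewrite coneE f0 coef0.
Qed.

Hypothesis a_neq0 : exists i, a i != 0.

Fact vanishing0 : vanishing_ideal 0.
Proof. by apply/vanishingE; exact: raddf0. Qed.
Fact vanishingD f g :
  vanishing_ideal f -> vanishing_ideal g -> vanishing_ideal (f + g).
Proof. by rewrite !vanishingE /cone mmapD => -> ->; rewrite addr0. Qed.
Fact vanishingMl f g : vanishing_ideal g -> vanishing_ideal (f * g).
Proof. by rewrite !vanishingE /cone (rmorphM (mmap _ _)) /= => ->; rewrite mulr0. Qed.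
Fact vanishing_prime f g :
  vanishing_ideal (f * g) -> vanishing_ideal f \/ vanishing_ideal g.
Proof.
rewrite !vanishingE /cone (rmorphM (mmap _ _)) /= => /eqP; rewrite mulf_eq0.
by case/orP => /eqP; [left|right].
Qed.
Fact vanishing_homog f d :
  vanishing_ideal f -> vanishing_ideal (pihomog mdeg d f).
Proof.
move=> f0 d'; have [->|dd'] := eqVneq d' d.
  by rewrite pihomog_dE ?f0 // pihomogP.
rewrite (@pihomog_ne0 _ _ _ d) ?pihomogP // 1?eq_sym //.
by rewrite (raddf0 (map_mpoly j)) (raddf0 (meval a)).
Qed.
Fact vanishing_relevant : exists i : 'I_n, ~ vanishing_ideal 'X_i.
Proof.
have [i ai] := a_neq0; exists i => /(_ 1%N)/eqP.
have Xi : ('X_i : {mpoly F[n]}) \is 1.-homog by rewrite dhomogX; apply/eqP/mdeg1.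
by rewrite pihomog_dE ?Xi // map_mpolyX mevalXU (negPf ai).
Qed.

Definition proj_point : proj n F :=
  Proj vanishing0 vanishingD vanishingMl vanishing_prime vanishing_homog
    vanishing_relevant.

End ProjPoint.

Section Plucker.
Variables (E : fieldType) (l m : nat).

(* Pluecker coordinates of the row space W of [A]: the coordinates of the line
   Lambda^(dim W) W in the whole exterior algebra of E^m. They are indexed by
   the subsets of 'I_m, those of cardinality different from dim W giving 0, so
   that the Grassmannians of all dimensions are embedded at once, as disjoint
   closed subschemes of P(Lambda E^m). *)
Definition plucker (A : 'M[E]_(l, m)) (s : 'I_#|{set 'I_m}|) : E :=
  let S : {set 'I_m} := enum_val s in
  if #|S| =P \rank A is ReflectT eqS
  then \det (mxsub (cast_ord eqS) enum_val (row_base A)) else 0.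

Lemma plucker_neq0 A : exists s, plucker A s != 0.
Proof.
have rfB : row_full (row_base A)^T by rewrite /row_full mxrank_tr eq_row_base.
pose f := fullrankfun rfB.
have cardS : #|[set: 'I_(\rank A)]%SET| = \rank A by rewrite cardsT card_ord.
pose S := imset f (mem [set: 'I_(\rank A)]%SET).
have eqS : #|S| = \rank A by rewrite card_imset //; exact: fullrankfun_inj.
exists (enum_rank S); rewrite /plucker enum_rankK.
case: eqP => // eqS'; rewrite -unitfE -unitmxE -row_free_unit.
apply: inj_row_free => v v0.
pose w : 'rV_(\rank A) := \row_i v 0 (cast_ord (esym eqS') i).
suff w0 : w = 0.
  apply/rowP => i; have /rowP/(_ (cast_ord eqS' i)) := w0.
  by rewrite !mxE cast_ordK.
have Cu : (rowsub f (row_base A)^T)^T \in unitmx.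
  by rewrite unitmx_tr fullrowsub_unit.
apply: (can_inj (mulmxK Cu)); rewrite mul0mx; apply/rowP => i.
have fiS : f i \in S by apply: imset_f; rewrite inE.
have /rowP/(_ (enum_rank_in fiS (f i))) := v0.
rewrite !mxE (reindex (cast_ord eqS')) /=; last first.
  by exists (cast_ord (esym eqS')) => ? _; rewrite ?cast_ordK ?cast_ordKV.
move=> v0i; rewrite -[RHS]v0i; apply: eq_bigr => k _.
by rewrite !mxE cast_ordK enum_rankK_in.
Qed.

End Plucker.

Section Grassmannian.
Variables (p r e : nat).

(* Coordinates of M_0 / u^e M_0: the entry (i, l, n) is the coefficient of
   epsilon_i u^n v_l. *)
Notation window := ('I_r * 'I_2 * 'I_e)%type.

Definition truncation (E : comPzRingType) (x : etale_module r E) :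
    'rV[E]_#|{: window}| :=
  \row_s let: (i, l, n) := enum_val s : window in x 0 l (nat_of_ord n)%:Z i.

(* The rows are all the elements of the subspace M / u^e M_0 of M_0 / u^e M_0. *)
Definition truncation_mx (E : finFieldType) (M : set (etale_module r E)) :=
  let W := finset (fun v => `[< exists2 x, M x & truncation x = v >]) in
  \matrix_(s < #|W|) (enum_val s : 'rV[E]_#|{: window}|).

Notation plucker_space F := (proj #|{set 'I_#|{: window}|}| F).

(* The image of the lattice [M], as an F'-point of the affine Grassmannian over
   F. By [gr_lattice_integral] and [gr_lattice_window] it is enough to consider
   the Grassmannian of M_0 / u^e M_0. *)
Definition gr_point (F F' : finFieldType) (j : {rmorphism F -> F'})
    (M : set (etale_module r F')) : plucker_space F :=
  proj_point j (plucker_neq0 (truncation_mx M)).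

(* The topological space underlying the reduced closed subscheme whose F'-points,
   for F'/F finite, are the lattices satisfying [gr_lattice]: the Zariski closure
   of these points. A finite extension F' of F is a finite field with a morphism
   F -> F'. *)
Definition gr_space (F : finFieldType) : set (plucker_space F) :=
  closure [set x | exists (F' : finFieldType) (j : {rmorphism F -> F'}) M,
    gr_lattice p e M /\ x = gr_point j M].

End Grassmannian.

Arguments gr_space : clear implicits.

(* Main.v *)
Require Import Defs.
From HB Require Import structures.
From mathcomp Require Import all_boot all_order all_algebra all_field.
From mathcomp Require Import boolp classical_sets topology_structure connected.
From mathcomp.multinomials Require Import mpoly.
From mathcomp Require Import zify ring.
Set Implicit Arguments.
Unset Strict Implicit.
Unset Printing Implicit Defensive.
Import Order.TTheory GRing.Theory Num.Theory.

                       

(** Write e = (p-1)m. The idempotents cut a lattice into a cyclic family of lattices M_i in E((u))^2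
    with phi(M_i) inside M_{i+1}, where phi acts on coordinates by u -> u^p. If d_i is the valuation
    of the determinant of a basis of M_i, the determinant condition reads p d_i = e + d_{i+1}, whose
    only cyclic solution is d_i = m; so lattices are the families described by [valid_family]
    ([gr_latticeP], and conversely [valid_gr_lattice]). By elementary divisors ([cartan]), M_i has a
    basis diag(u^{s_i}, u^{m-s_i}) G_i with 2 s_i <= m and G_i in SL_2(E[[u]]), and [valid_stdP]
    turns phi-stability into inequalities on the s_i and on the first rows of the G_i. If one s_i
    vanishes, all do, and the lattice splits off a line spanned by a vector fixed by phi, hence is
    ordinary ([ordinary_std]). A non-ordinary lattice therefore has all s_i >= 1.

    Connections come from projective lines. Suppose two lattices agree except at one index i0, where
    they are <a, u b> and <u a, b>, and put Y = <a, b>. The pencil with i0-component <a + t(b - a)>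
    + uY joins them. Since r >= 2, the neighbours of i0 are not affected: phi(M_{i0-1}) lies in both
    given lattices, hence in uY, and phi(Y) lies in M_{i0+1}, so every member of the pencil is
    phi-stable ([pencil_family_valid]). The points of a pencil are specialisations of its generic
    point, whose closure is connected, and this generic point lies in the closed space because its
    specialisations over finite fields do ([pencil_component], [adjacent_component]).

    It remains to move any non-ordinary lattice to a fixed one by such steps. Raising a minimal s_i
    by one is a pencil step that keeps the inequalities, because s_i >= 1 and p >= 2; so all s_i can
    be raised to h, the integral part of m/2 ([joined_half]). Then each G_i matters only modulo
    u^{m-2h}, that is not at all or as a point of the projective line over E, and is replaced by the
    identity with at most one more pencil ([joined_straighten]). All non-ordinary lattices thus meet
    at the standard one with s = h and G = 1. *)

(** * Orders of vanishing, monomials and constants in R((u)) *)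

Section OrderTheory.
Local Open Scope ring_scope.
Variable R : comPzRingType.
Implicit Types (f g : laurent R) (a b n : int).

Lemma order_geW a b (m n : nat) (A : 'M[laurent R]_(m, n)) :
  b <= a -> order_ge a A -> order_ge b A.
Proof. by move=> ba Aa i j t tb; apply: Aa; exact: lt_le_trans tb ba. Qed.

Lemma order_ge_mul0l a (m n l : nat) (A : 'M[laurent R]_(m, n)) (B : 'M_(n, l)) :
  order_ge 0 A -> order_ge a B -> order_ge a (A *m B).
Proof. by rewrite -{2}[a]add0r; exact: order_geM. Qed.

Lemma order_ge_mul0r a (m n l : nat) (A : 'M[laurent R]_(m, n)) (B : 'M_(n, l)) :
  order_ge a A -> order_ge 0 B -> order_ge a (A *m B).
Proof. by rewrite -{2}[a]addr0; exact: order_geM. Qed.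

Lemma order_geD a (m n : nat) (A B : 'M[laurent R]_(m, n)) :
  order_ge a A -> order_ge a B -> order_ge a (A + B).
Proof. by move=> Aa Ba i j t ta; rewrite mxE /= Aa ?Ba ?addr0. Qed.

Lemma order_geN a (m n : nat) (A : 'M[laurent R]_(m, n)) :
  order_ge a A -> order_ge a (- A).
Proof. by move=> Aa i j t ta; rewrite mxE /= Aa ?oppr0. Qed.

Lemma order_ge0 a (m n : nat) : order_ge a (0 : 'M[laurent R]_(m, n)).
Proof. by move=> i j t ta; rewrite mxE. Qed.

Lemma order_ge_tr a (m n : nat) (A : 'M[laurent R]_(m, n)) :
  order_ge a A -> order_ge a A^T.
Proof. by move=> Aa i j t ta; rewrite mxE Aa. Qed.

Lemma order_ge_monomial a n (m l : nat) (A : 'M[laurent R]_(m, l)) :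
  order_ge a A -> order_ge (n + a) (lmonomial R n *: A).
Proof. by move=> Aa i j t ta; rewrite mxE monomialM Aa //; lia. Qed.

Lemma order_ge_power_series a (f : laurent R) (m l : nat) (A : 'M[laurent R]_(m, l)) :
  power_series f -> order_ge a A -> order_ge a (f *: A).
Proof.
move=> f0 Aa i j t ta; rewrite mxE.
by apply: (lconv0 f0 (Aa i j)); rewrite add0r.
Qed.

Lemma monomialD a b : lmonomial R a * lmonomial R b = lmonomial R (a + b).
Proof.
apply/laurentP => n; rewrite monomialM /=; congr (nat_of_bool _)%:R.
by rewrite subr_eq addrC.
Qed.

Lemma monomial0 : lmonomial R 0 = 1. Proof. by []. Qed.

Lemma monomialK a : lmonomial R a * lmonomial R (- a) = 1.
Proof. by rewrite monomialD subrr. Qed.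

Lemma monomialKV a : lmonomial R (- a) * lmonomial R a = 1.
Proof. by rewrite monomialD addNr. Qed.

Lemma power_series_monomial (n : nat) : power_series (lmonomial R n%:Z).
Proof. by move=> t t0 /=; rewrite lt_eqF //; lia. Qed.

Lemma power_series1 : power_series (1 : laurent R).
Proof. exact: (power_series_monomial 0). Qed.

Lemma power_seriesM f g : power_series f -> power_series g -> power_series (f * g).
Proof. by move=> f0 g0 t t0; apply: (lconv0 f0 g0). Qed.

Lemma power_seriesD f g : power_series f -> power_series g -> power_series (f + g).
Proof. by move=> f0 g0 t t0 /=; rewrite f0 ?g0 ?addr0. Qed.

Lemma power_seriesN f : power_series f -> power_series (- f).
Proof. by move=> f0 t t0 /=; rewrite f0 ?oppr0. Qed.

Lemma monomial_subst (p : nat) a : (0 < p)%N ->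
  laurent_subst p (lmonomial R a) = lmonomial R (p%:Z * a).
Proof.
move=> p0; apply/laurentP => n /=; case: ifP => [/dvdzP [q ->]|pn].
  rewrite mulzK; last lia.
  by congr (nat_of_bool _)%:R; apply/eqP/eqP; nia.
by case: eqP pn => // ->; rewrite dvdz_mulr ?dvdzz.
Qed.

Lemma order_ge_subst (p : nat) a (m n : nat) (A : 'M[laurent R]_(m, n)) :
  (0 < p)%N -> order_ge a A -> order_ge (p%:Z * a) (map_mx (laurent_subst p) A).
Proof.
move=> p0 Aa i j t ta; rewrite mxE /=; case: ifP => // /dvdzP [q tq].
by rewrite tq mulzK ?Aa //; nia.
Qed.

Lemma power_series_subst (p : nat) f :
  (0 < p)%N -> power_series f -> power_series (laurent_subst p f).
Proof.
move=> p0 f0 t t0 /=; case: ifP => // /dvdzP [q tq].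
by rewrite tq mulzK ?f0 //; nia.
Qed.

Fact lconst_subproof (c : R) :
  exists N : int, forall n : int, n < N -> (if n == 0 then c else 0) = 0.
Proof. by exists 0 => n n0; rewrite lt_eqF. Qed.
Definition lconst c := Laurent (lconst_subproof c).

Lemma power_series_const c : power_series (lconst c).
Proof. by move=> t t0 /=; rewrite lt_eqF. Qed.

Lemma lconstM c f n : (lconst c * f) n = c * f n.
Proof.
have [b fb] := lcoef_bounded f.
have [N nN] : exists N : nat, n < 0 + b + N.+1%:Z.
  by exists (absz (n - b)%R).+1; lia.
rewrite -[LHS]/(lconv _ _ _) (lconvE (power_series_const c) fb nN).
rewrite big_ord_recl big1; first by rewrite addr0 /= ?addr0 ?subr0.
by move=> j _ /=; rewrite mul0r.
Qed.

Lemma lconst_mul (c d : R) : lconst (c * d) = lconst c * lconst d.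
Proof. by apply/laurentP => n; rewrite lconstM /=; case: eqP; rewrite ?mulr0. Qed.

Lemma lconst1 : lconst 1 = 1.
Proof. by apply/laurentP => n /=; case: eqP. Qed.

Lemma subst_const (p : nat) (c : R) : (0 < p)%N -> laurent_subst p (lconst c) = lconst c.
Proof.
move=> p0; apply/laurentP => n /=; case: ifP => [/dvdzP [q ->]|pn].
  rewrite mulzK; last lia.
  by rewrite mulf_eq0 -[p%:Z == 0]/(p == 0)%N eqn0Ngt p0 orbF.
by case: eqP pn => // ->; rewrite dvdz0.
Qed.

Lemma const_mod_u (f : laurent R) : power_series f ->
  exists2 g, power_series g & f = lconst (f 0) + lmonomial R 1 * g.
Proof.
move=> f0; exists (lmonomial R (-1) * (f - lconst (f 0))).
  move=> t t0; rewrite monomialM /=.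
  have [->|t1] := eqVneq t (-1); first by rewrite opprK addNr eqxx subrr.
  by rewrite f0 ?ifF ?subr0 //; lia.
by rewrite mulrA monomialK mul1r addrC subrK.
Qed.

                                                                                    
(** The inverse is the geometric series. As [h ^+ k] has order at least k, its n-th coefficient is
    that of the finite partial sum [S n]. *)
Lemma geometric_inverse (h : laurent R) : order_ge 1 (h%:M : 'M_1) ->
  exists2 g, power_series g & (1 - h) * g = 1.
Proof.
move=> h1.
have hk (k : nat) t : t < k%:Z -> (h ^+ k) t = 0.
  elim: k t => [|k IH] t tk; first by rewrite expr0 /= lt_eqF.
  rewrite exprS; apply: (lconv0 (a := 1) (b := k%:Z) _ IH); last by lia.
  by move=> i i1; have := h1 0 0 _ i1; rewrite mxE.
pose S (N : nat) : laurent R := \sum_(k < N.+1) h ^+ k.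
have SE N (n : nat) : (n <= N)%N -> S N n = S n n.
  elim: N => [|N IH]; first by rewrite leqn0 => /eqP ->.
  rewrite leq_eqVlt => /orP[/eqP-> //|nN]; rewrite -(IH nN).
  by rewrite /S big_ord_recr /= (hk N.+1) ?addr0 //; lia.
have gb : exists N : int, forall n : int, n < N ->
    (if 0 <= n then S (absz n) n else 0) = 0.
  by exists 0 => n n0; rewrite ifF //; lia.
exists (Laurent gb); first by move=> t t0 /=; rewrite ifF //; lia.
apply/laurentP => n.
have hp : power_series (1 - h).
  move=> t t0 /=; rewrite lt_eqF // add0r.
  by have := h1 0 0 t; rewrite mxE mulr1n => ->; rewrite ?oppr0 //; lia.
have [n0|n0] := ltP n 0.
  rewrite [RHS](power_series1 n0); apply: (lconv0 (a := 0) (b := 0)) => //.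
  by move=> t t0 /=; rewrite ifF //; lia.
have [k nk] : exists k : nat, n = k%:Z by exists (absz n); lia.
have Sp N : power_series (S N).
  move=> t t0; rewrite laurent_sumE big1 // => i _; apply: hk; lia.
have -> : ((1 - h) * Laurent gb) n = ((1 - h) * S k) n.
  rewrite -[LHS]/(lconv _ _ _) -[RHS]/(lconv _ _ _).
  rewrite (@lconvE _ (1 - h) (Laurent gb) 0 0 n k.+1) //; last lia.
    rewrite (lconvE hp (Sp k) (N := k.+1)); last lia.
    apply: eq_bigr => j _ /=; congr (_ * _); have := ltn_ord j => jk.
    rewrite ifT; last lia.
    rewrite [in RHS](_ : n - (0 + j%:Z) = (k - j)%N); last lia.
    rewrite (SE k) ?leq_subr // (_ : absz _ = (k - j)%N); last lia.
    by congr (S _ _); lia.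
  by move=> t t0 /=; rewrite ifF //; lia.
have -> : (1 - h) * S k = 1 - h ^+ k.+1.
  by rewrite -[1 - h ^+ _]opprB subrX1 -mulNr opprB.
by rewrite /= [X in _ - X](hk k.+1) ?subr0 // nk; lia.
Qed.

End OrderTheory.

(** * Units of E[[u]] and valuations over a field *)

Section LaurentField.
Local Open Scope ring_scope.
Variable E : fieldType.
Implicit Types (f g : laurent E).

Lemma power_series_inv f : power_series f -> f 0 != 0 ->
  exists2 g, power_series g & f * g = 1.
Proof.
move=> f0 fn0; pose c := lconst (f 0)^-1.
have [|g g0 fg] := @geometric_inverse E (1 - c * f).
  move=> i j t t1; rewrite !ord1 mxE mulr1n -[LHS]/((t == 0)%:R - (c * f) t) lconstM.
  have [->|tn0] := eqVneq t 0; first by rewrite mulVf ?subrr.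
  by rewrite [f t]f0 ?mulr0 ?subr0 //; lia.
exists (c * g); first exact/power_seriesM/g0/power_series_const.
by rewrite mulrCA mulrA -fg; ring.
Qed.

Lemma power_series_unit_coef0 f : power_series_unit f -> f 0 != 0.
Proof.
move=> [f0 [g g0 fg]]; apply/eqP => ff0.
have /laurentP/(_ 0) := fg; rewrite -[LHS]/(lconv _ _ _).
rewrite (lconvE f0 g0 (N := 1)) // big_ord1 addr0 ff0 mul0r /=.
by move/esym/eqP; rewrite oner_eq0.
Qed.

Lemma power_series_unitP f : power_series_unit f <-> power_series f /\ f 0 != 0.
Proof.
split=> [fu|[f0 fn0]]; last by split=> //; exact: power_series_inv.
by split; [case: fu | exact: power_series_unit_coef0].
Qed.

Lemma laurent_neq0_unit f : f != 0 ->
  exists d, exists2 v, power_series_unit v & f = v * lmonomial E d.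
Proof.
move=> fn0; have [N fN] := lcoef_bounded f.
have ex : exists n : nat, f (N + n%:Z) != 0.
  apply: contrapT => /forallNP fn; case/eqP: fn0; apply/laurentP => n /=.
  have [/fN//|Nn] := ltP n N.
  have /negP/negPn/eqP := fn (absz (n - N)%R); congr (f _ = _); lia.
have [d fd dmin] := ex_minnP ex.
exists (N + d%:Z), (lmonomial E (- (N + d%:Z)) * f); last first.
  by rewrite mulrAC monomialKV mul1r.
apply/power_series_unitP; split; last by rewrite monomialM sub0r opprK.
move=> t t0; rewrite monomialM opprK; apply/eqP; apply: contraT => ft.
have [/fN ft0|Nt] := ltP (t + (N + d%:Z)) N; first by rewrite ft0 eqxx in ft.
have := dmin (absz (t + d%:Z)%R); rewrite (_ : N + _ = t + (N + d%:Z)); last by lia.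
by move=> /(_ ft); lia.
Qed.

Lemma monomial_unit_inj (f g : laurent E) a b :
  power_series_unit f -> power_series_unit g ->
  f * lmonomial E a = g * lmonomial E b -> a = b.
Proof.
wlog ab : f g a b / a <= b => [H fu gu fg|].
  have [ab|/ltW ba] := leP a b; first exact: (H f g).
  by apply/esym; apply: (H g f).
move=> /power_series_unitP[f0 fn0] /power_series_unitP[g0 _].
rewrite ![_ * lmonomial _ _]mulrC => /laurentP/(_ a).
rewrite !monomialM subrr; have [->//|nab] := eqVneq a b.
by rewrite g0 => [/eqP fz|]; [rewrite fz in fn0 | lia].
Qed.

Lemma power_series_unitM f g :
  power_series_unit f -> power_series_unit g -> power_series_unit (f * g).
Proof.
move=> [f0 [f' f'0 ff]] [g0 [g' g'0 gg]]; split; first exact: power_seriesM.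
exists (f' * g'); first exact: power_seriesM.
by rewrite mulrACA ff gg mulr1.
Qed.

End LaurentField.

                                         

(** * Two-by-two determinants as an alternating form *)

Section Wedge.
Local Open Scope ring_scope.
Variable R : comPzRingType.

Let lift0E : lift ord0 ord0 = 1 :> 'I_2. Proof. exact/val_inj. Qed.
Let lift1E : lift 1 ord0 = 0 :> 'I_2. Proof. exact/val_inj. Qed.

Lemma ord2P (i : 'I_2) : i = 0 \/ i = 1.
Proof. by case: i => [[|[|//]] ip]; [left|right]; exact/val_inj. Qed.

Lemma mulmx2E (m n : nat) (A : 'M[R]_(m, 2)) (B : 'M[R]_(2, n)) i j :
  (A *m B) i j = A i 0 * B 0 j + A i 1 * B 1 j.
Proof. by rewrite mxE !big_ord_recl big_ord0 addr0 lift0E. Qed.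

Lemma det2E (A : 'M[R]_2) : \det A = A 0 0 * A 1 1 - A 0 1 * A 1 0.
Proof.
rewrite (expand_det_row _ 0) !big_ord_recl big_ord0 /cofactor !det_mx11 !mxE /=.
by rewrite expr0 expr1 mul1r addr0 mulN1r mulrN !ord1 lift0E lift1E.
Qed.

Definition row2 (a b : R) : 'rV[R]_2 := \row_j if j == 0 then a else b.

Definition rows2 (x y : 'rV[R]_2) : 'M[R]_2 :=
  \matrix_(i, j) if i == 0 then x 0 j else y 0 j.

Lemma det_rows2 x y : \det (rows2 x y) = x 0 0 * y 0 1 - x 0 1 * y 0 0.
Proof. by rewrite det2E !mxE. Qed.

Lemma rows2_mul x y (A : 'M[R]_2) : rows2 x y *m A = rows2 (x *m A) (y *m A).
Proof.
apply/matrixP => i j; rewrite mulmx2E !mxE !big_ord_recl !big_ord0 !addr0 !lift0E.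
by case: ifP.
Qed.

Lemma row2_mul a b (A : 'M[R]_2) : row2 a b *m A = a *: row 0 A + b *: row 1 A.
Proof. by apply/rowP => j; rewrite mulmx2E !mxE. Qed.

Lemma row2_rows2 a b x y : row2 a b *m rows2 x y = a *: x + b *: y.
Proof. by apply/rowP => j; rewrite mulmx2E !mxE. Qed.

Lemma rows2_row (A : 'M[R]_2) : rows2 (row 0 A) (row 1 A) = A.
Proof.
by apply/matrixP => i j; rewrite mxE !mxE; have [->|->] := ord2P i.
Qed.

Definition symp : 'M[R]_2 := rows2 (row2 0 1) (row2 (-1) 0).

                                                                        
(** The determinants of each row of [A] against each row of [B]; [symp] is the Gram matrix of this
    alternating form. *)
Definition wedge (m n : nat) (A : 'M[R]_(m, 2)) (B : 'M[R]_(n, 2)) : 'M[R]_(m, n) :=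
  A *m symp *m B^T.

Lemma wedgeE (m n : nat) (A : 'M[R]_(m, 2)) (B : 'M[R]_(n, 2)) i j :
  wedge A B i j = A i 0 * B j 1 - A i 1 * B j 0.
Proof. by rewrite /wedge !mulmx2E !mxE /=; ring. Qed.

Lemma wedgeMl (l m n : nat) (C : 'M[R]_(l, m)) A (B : 'M[R]_(n, 2)) :
  wedge (C *m A) B = C *m wedge A B.
Proof. by rewrite /wedge !mulmxA. Qed.

Lemma wedgeMr (l m n : nat) (C : 'M[R]_(l, n)) (A : 'M[R]_(m, 2)) B :
  wedge A (C *m B) = wedge A B *m C^T.
Proof. by rewrite /wedge trmx_mul !mulmxA. Qed.

Lemma wedge_tr (m n : nat) (A : 'M[R]_(m, 2)) (B : 'M[R]_(n, 2)) :
  (wedge A B)^T = - wedge B A.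
Proof. by apply/matrixP => i j; rewrite [LHS]mxE [RHS]mxE !wedgeE; ring. Qed.

Lemma wedge_self (A : 'M[R]_2) : wedge A A = \det A *: symp.
Proof.
apply/matrixP => i j; rewrite wedgeE det2E !mxE.
by have [->|->] := ord2P i; have [->|->] := ord2P j => /=; ring.
Qed.

Lemma symp_trK : symp *m symp^T = 1%:M.
Proof.
apply/matrixP => i j; rewrite mulmx2E !mxE.
by have [->|->] := ord2P i; have [->|->] := ord2P j => /=; ring.
Qed.

(** Cramer's rule: a vector is recovered from its determinants against a basis. *)
Lemma wedgeK (m : nat) (x : 'M[R]_(m, 2)) (B : 'M[R]_2) :
  wedge x B *m symp^T *m B = \det B *: x.
Proof.
apply/matrixP => i j; move: (wedge x B) (wedgeE x B) => W WE.
rewrite !mulmx2E !mxE /= !WE det2E.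
by have [->|->] := ord2P j; ring.
Qed.

End Wedge.

(** * Passing between (k (x) E)((u)) and its r factors E((u)) *)

Section Glue.
Local Open Scope ring_scope.
Variables (r : nat) (E : comPzRingType).

Definition lproj (i : 'I_r) : laurent (tens r E) -> laurent E :=
  laurent_map (@tens_proj r E i).
HB.instance Definition _ i := GRing.RMorphism.on (lproj i).

Lemma lprojE i (f : laurent (tens r E)) n : lproj i f n = f n i.
Proof. by []. Qed.

Lemma lproj_inj (f g : laurent (tens r E)) :
  (forall i, lproj i f = lproj i g) -> f = g.
Proof.
move=> fg; apply/laurentP => n; apply/ffunP => i.
by have /laurentP/(_ n) := fg i.
Qed.

Lemma lproj_mx_inj m n (A B : 'M[laurent (tens r E)]_(m, n)) :
  (forall i, map_mx (lproj i) A = map_mx (lproj i) B) -> A = B.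
Proof.
move=> AB; apply/matrixP => k l; apply: lproj_inj => i.
by have /matrixP/(_ k l) := AB i; rewrite !mxE.
Qed.

Lemma lproj_order a (m n : nat) (A : 'M[laurent (tens r E)]_(m, n)) :
  order_ge a A <-> forall i, order_ge a (map_mx (lproj i) A).
Proof.
split=> [Aa i k l t ta|Aa k l t ta]; first by rewrite mxE lprojE Aa ?ffunE.
by apply/ffunP => i; have := Aa i k l t ta; rewrite mxE lprojE ffunE.
Qed.

Lemma lproj_power_series i (f : laurent (tens r E)) :
  power_series f -> power_series (lproj i f).
Proof. by move=> f0 t t0; rewrite lprojE f0 ?ffunE. Qed.

Lemma lproj_monomial i n : lproj i (lmonomial _ n) = lmonomial E n.
Proof. by apply/laurentP => t; rewrite -[LHS]/(tens_proj i (t == n)%:R) rmorph_nat. Qed.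

Fact glue_subproof (f : 'I_r -> laurent E) :
  exists N : int, forall n : int, n < N -> ([ffun i => f i n] : tens r E) = 0.
Proof.
have /choice[N fN] : forall i, exists N : nat, forall t : int, t < - N%:Z -> f i t = 0.
  by move=> i; have [N fN] := lcoef_bounded (f i); exists (absz N) => t tN; apply: fN; lia.
exists (- (\max_i N i)%N%:Z) => n nN; apply/ffunP => i; rewrite !ffunE fN //.
have : (N i <= \max_i N i)%N by exact: leq_bigmax.
lia.
Qed.
Definition glue (f : 'I_r -> laurent E) : laurent (tens r E) :=
  Laurent (glue_subproof f).

Lemma glueK f i : lproj i (glue f) = f i.
Proof. by apply/laurentP => n; rewrite lprojE /= ffunE. Qed.

Definition glue_mx m n (A : 'I_r -> 'M[laurent E]_(m, n)) :
  'M[laurent (tens r E)]_(m, n) := \matrix_(k, l) glue (fun i => A i k l).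

Lemma glue_mxK m n (A : 'I_r -> 'M[laurent E]_(m, n)) i :
  map_mx (lproj i) (glue_mx A) = A i.
Proof. by apply/matrixP => k l; rewrite !mxE glueK. Qed.

Lemma lproj_phi p (x : etale_module r E) i :
  map_mx (lproj (ordS i)) (phi p x) = map_mx (laurent_subst p) (map_mx (lproj i) x).
Proof.
apply/matrixP => k l; rewrite !mxE; apply/laurentP => n.
rewrite lprojE /=; case: ifP => [_|_]; [exact: tens_frobE | by rewrite ffunE].
Qed.

End Glue.

(** * Lattices as cyclic families of bases *)

Section Families.
Local Open Scope ring_scope.
Local Open Scope classical_set_scope.
Variables (p r m : nat) (E : comPzRingType).
Hypothesis p_gt1 : (1 < p)%N.
Implicit Types (B D : 'I_r -> 'M[laurent E]_2).

Definition lattice_of D : set (etale_module r E) :=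
  [set x | forall i, exists2 c : 'rV_2, order_ge 0 c &
    map_mx (lproj i) x = c *m D i].

                                                                             
                                                                                
                                                                
(** By [row_spanP] the last condition says that phi maps the span of [B i] into that of
    [B (ordS i)]. Stating it through determinants avoids a quantifier over transition matrices and
    makes it visibly stable under base change. *)
Definition valid_family B : Prop :=
  forall i, [/\ order_ge 0 (B i), \det (B i) = lmonomial E m%:Z
    & order_ge m%:Z (wedge (map_mx (laurent_subst p) (B i)) (B (ordS i)))].

Lemma order_ge_symp : order_ge 0 (symp (laurent E)).
Proof.
move=> i j t t0; rewrite !mxE; case: ifP; case: ifP => // _ _.
  by rewrite power_series1.
by rewrite power_seriesN //; exact: power_series1.
Qed.

(** Cramer's rule: up to sign, the coordinates of [x] in the rows of [A] are its determinants
    against these rows divided by u^a, so they are integral exactly when the determinants have order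
    at least a. *)
Lemma row_spanP (a : nat) n (x : 'M[laurent E]_(n, 2)) (A : 'M_2) :
  \det A = lmonomial E a%:Z ->
  order_ge a%:Z (wedge x A) <-> exists2 c, order_ge 0 c & x = c *m A.
Proof.
move=> detA; have J0 := order_ge_tr order_ge_symp; split=> [xA|[c c0 ->]]; last first.
  rewrite wedgeMl wedge_self detA -[X in order_ge X]addr0; apply: order_ge_mul0l => //.
  by apply: order_ge_monomial; exact: order_ge_symp.
exists (lmonomial E (- a%:Z) *: (wedge x A *m (symp _)^T)).
  rewrite -(addNr a%:Z); apply: order_ge_monomial.
  exact: order_ge_mul0r.
by rewrite -scalemxAl wedgeK detA scalerA monomialKV scale1r.
Qed.

Lemma cancel_det n (a : int) (x y : 'M[laurent E]_(n, 2)) (A : 'M_2) :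
  \det A = lmonomial E a -> x *m A = y *m A -> x = y.
Proof.
move=> detA /(congr1 (mulmx^~ (lmonomial E (- a) *: \adj A))).
rewrite -!scalemxAr -!mulmxA !mul_mx_adj detA !mul_mx_scalar !scalerA.
by rewrite monomialKV !scale1r.
Qed.

Variable B : 'I_r -> 'M[laurent E]_2.
Hypothesis Bval : valid_family B.

Lemma mem_lattice_of x :
  lattice_of B x <-> forall i, order_ge m%:Z (wedge (map_mx (lproj i) x) (B i)).
Proof.
by split=> Bx i; have := Bx i; have [_ detB _] := Bval i; move/(row_spanP _ detB).
Qed.

Lemma lattice_of_glue x :
  lattice_of B x <-> exists2 c : 'rV_2, power_series_mx c & c *m glue_mx B = x.
Proof.
split=> [Bx|[c c0 <-] i]; last first.
  by exists (map_mx (lproj i) c); [exact: (proj1 (lproj_order 0 c) c0) | rewrite map_mxM glue_mxK].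
have /choice[c cP] : forall i, exists c : 'rV_2,
    order_ge 0 c /\ map_mx (lproj i) x = c *m B i.
  by move=> i; have [c] := Bx i; exists c.
exists (glue_mx c).
  by apply/(lproj_order 0) => i; rewrite glue_mxK; case: (cP i).
by apply: lproj_mx_inj => i; rewrite map_mxM !glue_mxK; case: (cP i).
Qed.

Lemma lattice_of_basis : is_basis (lattice_of B) (glue_mx B).
Proof.
split.
  rewrite predeqE => x; split=> [/lattice_of_glue[c c0 <-]|[c c0 <-]].
    by exists c.
  by apply/lattice_of_glue; exists c.
move=> c _ cB; apply: lproj_mx_inj => i; rewrite map_mx0.
have [_ detB _] := Bval i; apply: (cancel_det detB).
by rewrite mul0mx -(glue_mxK B i) -map_mxM cB map_mx0.
Qed.

(** Any basis of a component differs from [B i] by an invertible matrix of power series, so its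
    determinant is a unit times u^m. The matrix of phi then has determinant a unit times u^{pm-m},
    and pm - m = e. *)
Lemma valid_gr_lattice e : (p.-1 * m = e)%N -> gr_lattice p e (lattice_of B).
Proof.
move=> me; have p_gt0 : (0 < p)%N by lia.
split; first by exists (glue_mx B); exact: lattice_of_basis.
- move=> x; have [a xa] := order_ge_exists x; exists (m + a)%N.
  apply/mem_lattice_of => i; have [B0 _ _] := Bval i.
  have -> : map_mx (lproj i) (lmonomial (tens r E) (m + a)%N%:Z *: x) =
      lmonomial E (m + a)%N *: map_mx (lproj i) x.
    by apply/matrixP => k l; rewrite !mxE (rmorphM (lproj i)) /= lproj_monomial.
  rewrite /wedge -!scalemxAl.
  have -> : m%:Z = (m + a)%N%:Z + (- a%:Z) by lia.
  apply: order_ge_monomial; rewrite -/(wedge _ _).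
  apply: order_ge_mul0r; last exact: order_ge_tr.
  by apply: order_ge_mul0r; [exact: (proj1 (lproj_order _ x) xa) | exact: order_ge_symp].
- move=> x Bx; apply/mem_lattice_of => j; rewrite -(ord_predK j) lproj_phi.
  have [c c0 ->] := Bx (ord_pred j); rewrite map_mx_substM // wedgeMl.
  have [_ _ Bw] := Bval (ord_pred j); apply: order_ge_mul0l => //.
  by rewrite -(mulr0 p%:Z); exact: order_ge_subst.
move=> i A A' C AB AB' C0 AC.
have det_basis j X : is_basis (component j (lattice_of B)) X ->
    exists2 v, power_series_unit v & \det X = v * lmonomial E m%:Z.
  move=> [XB _]; have [_ detB _] := Bval j.
  have compE : component j (lattice_of B) =
      [set c *m B j | c in [set c : 'rV_2 | power_series_mx c]].
    have glueB : glue_mx B *m glue_mx (fun j => lmonomial E (- m%:Z) *: \adj (B j)) = 1%:M.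
      apply: lproj_mx_inj => l; rewrite map_mxM !glue_mxK map_mx1.
      rewrite -scalemxAr mul_mx_adj; have [_ -> _] := Bval l.
      by rewrite scale_scalar_mx monomialKV.
    have [-> _] := component_basis j lattice_of_basis glueB.
    by rewrite -/(lproj j) glue_mxK.
  have [U U0 XU] : exists2 U, order_ge 0 U & X = U *m B j.
    have /choice[U UP] : forall l, exists c : 'rV_2, order_ge 0 c /\ c *m B j = row l X.
      move=> l; have : component j (lattice_of B) (row l X).
        rewrite XB; exists (delta_mx 0 l); last by rewrite rowE.
        by move=> s t n n0; rewrite mxE; case: (_ && _); rewrite ?power_series1.
      by rewrite compE => -[c c0 cX]; exists c.
    exists (\matrix_l U l); first by move=> s t n n0; rewrite mxE (UP s).1.
    by apply/row_matrixP => l; rewrite row_mul rowK (UP l).2.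
  have [V V0 BV] : exists2 V, order_ge 0 V & B j = V *m X.
    have /choice[V VP] : forall l, exists c : 'rV_2, order_ge 0 c /\ c *m X = row l (B j).
      move=> l; have : component j (lattice_of B) (row l (B j)).
        rewrite compE; exists (delta_mx 0 l); last by rewrite rowE.
        by move=> s t n n0; rewrite mxE; case: (_ && _); rewrite ?power_series1.
      by rewrite XB => -[c c0 cX]; exists c.
    exists (\matrix_l V l); first by move=> s t n n0; rewrite mxE (VP s).1.
    by apply/row_matrixP => l; rewrite row_mul rowK (VP l).2.
  have VU : V *m U = 1%:M.
    by apply: (cancel_det detB); rewrite -mulmxA -XU -BV mul1mx.
  exists (\det U); last by rewrite XU det_mulmx detB.
  split; first exact: order_ge_det.
  exists (\det V); first exact: order_ge_det.
  by rewrite mulrC -det_mulmx VU det1.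
have [v [v0 [v' v'0 vv']] detA] := det_basis _ _ AB.
have [w [w0 [w' w'0 ww']] detA'] := det_basis _ _ AB'.
have substA : laurent_subst p (\det A) = \det C * \det A'.
  rewrite -det_mulmx -AC !det2E !mxE.
  by rewrite (raddfB (laurent_subst p)) /= !laurent_substM.
exists (laurent_subst p v * w').
  split; first by apply: power_seriesM => //; exact: power_series_subst.
  exists (laurent_subst p v' * w).
    by apply: power_seriesM => //; exact: power_series_subst.
  rewrite mulrACA -laurent_substM // vv' laurent_subst1 // mul1r.
  by rewrite mulrC.
have -> : \det C = \det C * \det A' * (w' * lmonomial E (- m%:Z)).
  by rewrite detA' -mulrA mulrACA ww' monomialK !mulr1.
rewrite -substA detA laurent_substM // monomial_subst // mulrACA monomialD.
by congr (_ * lmonomial _ _); lia.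
Qed.

End Families.

Section LatticeFamily.
Local Open Scope ring_scope.
Local Open Scope classical_set_scope.

Lemma power_series_row2 (R : comPzRingType) (f g : laurent R) :
  power_series f -> power_series g -> order_ge 0 (row2 f g).
Proof. by move=> f0 g0 i j t t0; rewrite mxE; case: ifP => _; rewrite ?f0 ?g0. Qed.

Lemma order_ge_rows2 (R : comPzRingType) a (x y : 'rV[laurent R]_2) :
  order_ge a x -> order_ge a y -> order_ge a (rows2 x y).
Proof. by move=> xa ya i j t ta; rewrite mxE; case: ifP => _; rewrite ?xa ?ya. Qed.

(** At an index where the absolute value of [f] is maximal, its p-fold is no larger, so the maximum
    is 0. *)
Lemma cyclic_scaling_eq0 (p r : nat) (f : 'I_r -> int) : (1 < p)%N ->
  (forall i, f (ordS i) = p%:Z * f i) -> forall i, f i = 0.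
Proof.
move=> p1 fS i; have [j _ jmax] := @arg_maxnP _ i xpredT (fun i => absz (f i)) isT.
have := jmax (ordS j) isT; have := jmax i isT; rewrite fS; nia.
Qed.

(** The valuations d_i of the determinants satisfy p d_i = e + d_{i+1}, so d_i - m is multiplied by
    p at each step of the cycle and vanishes. Dividing the second basis vector by the remaining unit
    (the matrices [Q i]) makes the determinant exactly u^m. *)
Lemma gr_latticeP (p r m e : nat) (E : fieldType) (M : set (etale_module r E)) :
  (1 < p)%N -> (p.-1 * m = e)%N -> gr_lattice p e M ->
  exists2 B, valid_family p m B & M = lattice_of B.
Proof.
move=> p_gt1 me latM; have p_gt0 : (0 < p)%N by lia.
have [[B BM] spanM phiM detM] := latM; have [MB _] := BM.
have rowM l : M (row l B).
  rewrite MB; exists (delta_mx 0 l); last by rewrite rowE.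
  by move=> s t n n0; rewrite mxE; case: (_ && _); rewrite ?power_series1.
have B0 : order_ge 0 B.
  move=> k l t t0; have := gr_lattice_integral p_gt1 latM (rowM k) 0 l t0.
  by rewrite mxE.
(* [B] is invertible over the Laurent series because M contains u^e M_0. *)
have [D BD] : exists D, B *m D = 1%:M.
  have /choice[d dB] : forall l : 'I_2, exists d : 'rV_2,
      d *m B = lmonomial _ e%:Z *: delta_mx 0 l.
    move=> l; have : M (lmonomial _ e%:Z *: delta_mx 0 l).
      apply: (gr_lattice_window p_gt1 latM) => s t n n0.
      by rewrite mxE; case: (_ && _); rewrite ?power_series1.
    by rewrite MB => -[d _ dB]; exists d.
  exists (lmonomial _ (- e%:Z) *: \matrix_l d l).
  apply: mulmx1C; apply/row_matrixP => l.
  rewrite row_mul linearZ /= rowK -scalemxAl dB scalerA monomialKV scale1r.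
  by rewrite row1.
have [C C0 CB] : exists2 C : 'M_2, order_ge 0 C &
    map_mx (fun f => laurent_subst p (laurent_map (@tens_frob r E) f)) B = C *m B.
  have /choice[c cB] : forall l, exists c : 'rV_2, order_ge 0 c /\
      c *m B = phi p (row l B).
    by move=> l; have := phiM _ (rowM l); rewrite MB => -[c c0 cB]; exists c.
  exists (\matrix_l c l).
    by move=> l k n n0; rewrite mxE (cB l).1.
  by apply/row_matrixP => l; rewrite row_mul rowK (cB l).2; apply/rowP => k; rewrite !mxE.
pose b i := map_mx (lproj i) B.
have bS i : map_mx (laurent_subst p) (b i) = map_mx (lproj (ordS i)) C *m b (ordS i).
  rewrite -map_mxM -CB; apply/matrixP => k l.
  by have /matrixP/(_ 0 l) := lproj_phi p (row k B) i; rewrite !mxE => <-.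
have Cpr i : order_ge 0 (map_mx (lproj i) C) := proj1 (lproj_order 0 C) C0 i.
have detC i : exists2 alpha, power_series_unit alpha &
    \det (map_mx (lproj (ordS i)) C) = alpha * lmonomial E e%:Z.
  exact: detM (component_basis i BM BD) (component_basis (ordS i) BM BD) (Cpr _) (bS i).
have detB i : exists dv, power_series_unit dv.2 /\ \det (b i) = dv.2 * lmonomial E dv.1.
  have : \det (b i) != 0.
    apply/eqP => b0; have := congr1 (fun A => \det (map_mx (lproj i) A)) BD.
    rewrite map_mxM det_mulmx map_mx1 det1 b0 mul0r => /laurentP/(_ 0) /=.
    by move/esym/eqP; rewrite oner_eq0.
  by case/laurent_neq0_unit => d [v vu bE]; exists (d, v).
have {detB} /choice[dv dvP] := detB.
have detS i : p%:Z * (dv i).1 = e%:Z + (dv (ordS i)).1.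
  have [alpha alphau detCi] := detC i.
  have [[v0 [v' v'0 vv]] bi] := dvP i; have [wu bSi] := dvP (ordS i).
  apply: (@monomial_unit_inj E (laurent_subst p (dv i).2) (alpha * (dv (ordS i)).2)).
  - split; first exact: power_series_subst.
    exists (laurent_subst p v'); first exact: power_series_subst.
    by rewrite -laurent_substM // vv laurent_subst1.
  - exact: power_series_unitM.
  rewrite -monomialD mulrACA -detCi -bSi -det_mulmx -bS -monomial_subst //.
  rewrite -laurent_substM // -bi !det2E !mxE.
  by rewrite (raddfB (laurent_subst p)) /= !laurent_substM.
have {detS} dm i : (dv i).1 = m%:Z.
  apply/eqP; rewrite -subr_eq0; apply/eqP; move: i.
  by apply: (cyclic_scaling_eq0 p_gt1) => i; have := detS i; nia.
have /choice[w wP] : forall i, exists w, power_series w /\ (dv i).2 * w = 1.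
  by move=> i; have [[_ [w w0 vw]] _] := dvP i; exists w.
pose Q i : 'M[laurent E]_2 := rows2 (row2 1 0) (row2 0 (w i)).
pose Q' i : 'M[laurent E]_2 := rows2 (row2 1 0) (row2 0 (dv i).2).
have QQ i : Q' i *m Q i = 1%:M.
  rewrite rows2_mul !row2_mul; apply/matrixP => k l; rewrite !mxE.
  have [_ vw] := wP i.
  by have [->|->] := ord2P k; have [->|->] := ord2P l; rewrite /= ?vw; ring.
have p0 : power_series (0 : laurent E) by [].
have p1 : power_series (1 : laurent E) by exact: power_series1.
have Q0 i : order_ge 0 (Q i).
  by apply: order_ge_rows2; apply: power_series_row2 => //; case: (wP i).
have Q'0 i : order_ge 0 (Q' i).
  by apply: order_ge_rows2; apply: power_series_row2 => //; case: (dvP i) => -[].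
have detQ i : \det (Q i *m b i) = lmonomial E m%:Z.
  rewrite det_mulmx det_rows2 !mxE /= mul1r mul0r subr0.
  by have [_ ->] := dvP i; rewrite mulrA [w i * _]mulrC (wP i).2 mul1r dm.
exists (fun i => Q i *m b i).
  move=> i; split=> //.
    by apply: order_ge_mul0l => //; exact: (proj1 (lproj_order 0 B) B0).
  apply/(row_spanP _ (detQ _)).
  exists (map_mx (laurent_subst p) (Q i) *m (map_mx (lproj (ordS i)) C *m Q' (ordS i))).
    apply: order_ge_mul0l; last exact: order_ge_mul0l.
    by rewrite -(mulr0 p%:Z); exact: order_ge_subst.
  rewrite map_mx_substM // bS -!mulmxA; congr (_ *m (_ *m _)).
  by rewrite mulmxA QQ mul1mx.
rewrite MB predeqE => x; split=> [[c c0 <-] i|xP].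
  exists (map_mx (lproj i) c *m Q' i).
    by apply: order_ge_mul0l => //; exact: (proj1 (lproj_order 0 c) c0).
  by rewrite map_mxM -mulmxA [Q' i *m _]mulmxA QQ mul1mx.
have /choice[c cP] : forall i, exists c : 'rV_2,
    order_ge 0 c /\ map_mx (lproj i) x = c *m (Q i *m b i).
  by move=> i; have [c] := xP i; exists c.
exists (glue_mx (fun i => c i *m Q i)).
  apply/(lproj_order 0) => i; rewrite glue_mxK.
  by apply: order_ge_mul0l => //; case: (cP i).
by apply: lproj_mx_inj => i; rewrite map_mxM glue_mxK (cP i).2 mulmxA.
Qed.

End LatticeFamily.

                                      

(** * Elementary divisors in rank two *)

Section Cartan.
Local Open Scope ring_scope.
Local Open Scope classical_set_scope.
Variable E : fieldType.

Definition special (A : 'M[laurent E]_2) : Prop := order_ge 0 A /\ \det A = 1.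

Lemma adj2_mul (R : comPzRingType) (A : 'M[R]_2) : \det A = 1 -> \adj A *m A = 1%:M.
Proof. by move=> detA; rewrite mul_adj_mx detA. Qed.

Lemma special_adj A : special A -> special (\adj A).
Proof.
move=> [A0 detA]; split; first exact: order_ge_adj.
have := congr1 (fun X => \det X) (adj2_mul detA).
by rewrite det_mulmx detA mulr1 det1.
Qed.

Lemma unimodular_row (w : 'rV[laurent E]_2) l : order_ge 0 w -> w 0 l 0 != 0 ->
  exists2 w', order_ge 0 w' & \det (rows2 w w') = 1.
Proof.
move=> w0 wl; have [g g0 wg] := power_series_inv (w0 0 l) wl.
have p0 : power_series (0 : laurent E) by [].
have [l0|l1] := ord2P l.
  exists (row2 0 g); first exact: power_series_row2.
  by rewrite det_rows2 !mxE /= mulr0 subr0 -l0 wg.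
exists (row2 (- g) 0); first by apply: power_series_row2 => //; exact: power_seriesN.
by rewrite det_rows2 !mxE /= mulr0 sub0r mulrN opprK -l1 wg.
Qed.

Variable m : nat.

Definition diag2 (s : nat) : 'M[laurent E]_2 :=
  rows2 (row2 (lmonomial E s%:Z) 0) (row2 0 (lmonomial E (m%:Z - s%:Z))).

Lemma diag2_mul s (G : 'M[laurent E]_2) : diag2 s *m G =
  rows2 (lmonomial E s%:Z *: row 0 G) (lmonomial E (m%:Z - s%:Z) *: row 1 G).
Proof. by rewrite rows2_mul !row2_mul !scale0r addr0 add0r. Qed.

Lemma det_diag2 s : \det (diag2 s) = lmonomial E m%:Z.
Proof.
rewrite det_rows2 !mxE /= mul0r subr0 monomialD; congr lmonomial; lia.
Qed.

Lemma det_std s G : special G -> \det (diag2 s *m G) = lmonomial E m%:Z.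
Proof. by move=> [_ detG]; rewrite det_mulmx det_diag2 detG mulr1. Qed.

Lemma order_ge_diag2 s : (s <= m)%N -> order_ge 0 (diag2 s).
Proof.
move=> sm; have p0 : power_series (0 : laurent E) by [].
apply: order_ge_rows2; apply: power_series_row2 => //.
  exact: power_series_monomial.
rewrite (_ : m%:Z - s%:Z = (m - s)%N); last by lia.
exact: power_series_monomial.
Qed.

Lemma order_ge_std s G : (s <= m)%N -> special G -> order_ge 0 (diag2 s *m G).
Proof. by move=> sm [G0 _]; apply: order_ge_mul0l => //; exact: order_ge_diag2. Qed.

(** Let s be the least order of an entry. A row attaining it is u^s times a unimodular row, which is
    completed to G in SL_2. Then x = u^{-s} B G^{-1} is integral with first row (1, 0) and
    determinant u^{m-2s}; integrality gives 2s <= m, and a unipotent row operation makes x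
    diagonal. *)
Lemma cartan (B : 'M[laurent E]_2) : order_ge 0 B -> \det B = lmonomial E m%:Z ->
  exists s, exists G, [/\ (s.*2 <= m)%N, special G
    & exists2 U, special U & B = U *m (diag2 s *m G)].
Proof.
move=> B0 detB.
have ex : exists n : nat, [exists k, exists l, B k l n%:Z != 0].
  apply: contrapT => /forallNP Bn.
  have B00 : B = 0.
    apply/matrixP => k l; apply/laurentP => n; rewrite mxE.
    have [/B0 //|n0] := ltP n 0.
    have /negP := Bn (absz n); rewrite negb_exists => /forallP/(_ k).
    rewrite negb_exists => /forallP/(_ l); rewrite negbK => /eqP.
    by rewrite (_ : (absz n)%:Z = n) //; lia.
  have := detB; rewrite B00 det0 => /laurentP/(_ m%:Z)/eqP /=.
  by rewrite eqxx eq_sym oner_eq0.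
have [s sP smin] := ex_minnP ex.
have Bs : order_ge s%:Z B.
  move=> k l t ts; have [/B0 //|t0] := ltP t 0.
  apply/eqP; apply: contraT => Bt.
  suff : (s <= absz t)%N by lia.
  apply: smin; apply/existsP; exists k; apply/existsP; exists l.
  by rewrite (_ : (absz t)%:Z = t) //; lia.
(* Multiplication by [symp] exchanges the two rows up to sign. *)
wlog [l Bl] : B B0 detB {ex sP smin} Bs / exists l, B 0 l s%:Z != 0.
  move=> H; have /existsP[k /existsP[l Bkl]] := sP.
  have [k0|k1] := ord2P k; first by apply: H => //; exists l; rewrite -k0.
  pose P : 'M[laurent E]_2 := symp _.
  have spP : special P^T.
    split; first exact/order_ge_tr/order_ge_symp.
    by rewrite det_tr det_rows2 !mxE /=; ring.
  have [||||s' [G [sm Gs [U Us PB]]]] := H (P *m B).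
  - by apply: order_ge_mul0l => //; exact: order_ge_symp.
  - by rewrite det_mulmx -det_tr (spP.2) mul1r.
  - by apply: order_ge_mul0l => //; exact: order_ge_symp.
  - exists l; have -> : (P *m B) 0 l = B k l; last by [].
    by rewrite k1 mulmx2E !mxE /=; ring.
  exists s', G; split=> //; exists (P^T *m U).
    split; first by apply: order_ge_mul0l; [case: spP | case: Us].
    by rewrite det_mulmx (spP.2) mul1r (Us.2).
  rewrite -mulmxA -PB mulmxA (_ : P^T *m P = 1%:M) ?mul1mx //.
  exact/mulmx1C/symp_trK.
pose w := lmonomial E (- s%:Z) *: row 0 B.
have w0 : order_ge 0 w.
  rewrite -(addNr s%:Z); apply: order_ge_monomial => k l' t ts.
  by rewrite mxE Bs.
have [|w' w'0 detG] := @unimodular_row w l w0.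
  by rewrite !mxE monomialM sub0r opprK.
have Gs : special (rows2 w w') by split=> //; exact: order_ge_rows2.
have [x xE] : exists x, x = lmonomial E (- s%:Z) *: (B *m \adj (rows2 w w')).
  by eexists.
have BE : B = lmonomial E s%:Z *: (x *m rows2 w w').
  by rewrite xE -scalemxAl scalerA monomialK scale1r -mulmxA adj2_mul // mulmx1.
have x0 : order_ge 0 x.
  rewrite xE -(addNr s%:Z); apply: order_ge_monomial.
  by apply: order_ge_mul0r => //; exact: order_ge_adj (Gs.1).
have xrow : row 0 x = row2 1 0.
  apply: (@cancel_det _ 1 0 _ _ (rows2 w w')); first by rewrite detG.
  rewrite row2_rows2 scale1r scale0r addr0 -row_mul.
  by rewrite [in RHS]/w [in RHS]BE linearZ /= scalerA monomialKV scale1r.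
have xx00 : x 0 0 = 1 by have /rowP/(_ 0) := xrow; rewrite !mxE.
have xx01 : x 0 1 = 0 by have /rowP/(_ 1) := xrow; rewrite !mxE.
have x11 : x 1 1 = lmonomial E (m%:Z - s%:Z - s%:Z).
  have := detB; rewrite BE detZ det_mulmx detG mulr1 [\det x]det2E xx00 xx01.
  rewrite mul1r mul0r subr0 expr2 monomialD.
  move/(congr1 (fun f => lmonomial E (- (s%:Z + s%:Z)) * f)).
  by rewrite mulrA monomialKV mul1r monomialD => ->; congr lmonomial; lia.
have sm : (s.*2 <= m)%N.
  rewrite leqNgt; apply/negP => sm.
  have : (x 1 1) (m%:Z - s%:Z - s%:Z) = 0 by apply: x0; lia.
  by move/eqP; rewrite x11 /= eqxx oner_eq0.
exists s, (rows2 w w'); split => //.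
exists (rows2 (row2 1 0) (row2 (x 1 0) 1)).
  split; last by rewrite det_rows2 !mxE /=; ring.
  have p0 : power_series (0 : laurent E) by [].
  have p1 := @power_series1 E.
  by apply: order_ge_rows2; apply: power_series_row2 => //; exact: x0.
rewrite {1}BE mulmxA scalemxAl; congr (_ *m _).
apply/matrixP => k l'; rewrite rows2_mul !row2_mul !mxE /=.
have [->|->] := ord2P k; have [->|->] := ord2P l'; rewrite /= ?xx00 ?xx01 ?x11; try ring.
by rewrite mulr0 add0r mul1r monomialD; congr lmonomial; lia.
Qed.

End Cartan.

(** * Standard form of a lattice: exponents s_i and matrices G_i *)

Section Standard.
Local Open Scope ring_scope.
Local Open Scope classical_set_scope.

Definition laurent_ge (R : comPzRingType) (a : int) (f : laurent R) : Prop :=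
  forall t : int, t < a -> f t = 0.

Section LaurentGe.
Variable R : comPzRingType.
Implicit Types (f g : laurent R) (a b : int).

Lemma laurent_geM a b f g :
  laurent_ge a f -> laurent_ge b g -> laurent_ge (a + b) (f * g).
Proof. by move=> fa gb t tab; exact: (lconv0 fa gb). Qed.

Lemma laurent_geMl a f g : laurent_ge 0 f -> laurent_ge a g -> laurent_ge a (f * g).
Proof. by move=> f0 ga; rewrite -[a]add0r; exact: laurent_geM. Qed.

Lemma laurent_geMr a f g : laurent_ge a f -> laurent_ge 0 g -> laurent_ge a (f * g).
Proof. by move=> f0 ga; rewrite -[a]addr0; exact: laurent_geM. Qed.

Lemma laurent_geD a f g : laurent_ge a f -> laurent_ge a g -> laurent_ge a (f + g).
Proof. by move=> fa ga t ta /=; rewrite fa ?ga ?addr0. Qed.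

Lemma laurent_geN a f : laurent_ge a f -> laurent_ge a (- f).
Proof. by move=> fa t ta /=; rewrite fa ?oppr0. Qed.

Lemma laurent_geW a b f : a <= b -> laurent_ge b f -> laurent_ge a f.
Proof. by move=> ab fb t ta; apply: fb; exact: lt_le_trans ta ab. Qed.

Lemma laurent_ge_monomial a b f : laurent_ge (a - b) f -> laurent_ge a (lmonomial R b * f).
Proof. by move=> fa t ta; rewrite monomialM fa //; lia. Qed.

Lemma laurent_ge_monomialV a b f : laurent_ge a (lmonomial R b * f) -> laurent_ge (a - b) f.
Proof.
move=> fa t ta; have := fa (t + b); rewrite monomialM addrK; apply; lia.
Qed.

Lemma laurent_ge_subst (p : nat) a f : (0 < p)%N ->
  laurent_ge a f -> laurent_ge (p%:Z * a) (laurent_subst p f).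
Proof.
move=> p0 fa t ta /=; case: ifP => // /dvdzP [q tq].
by rewrite tq mulzK ?fa //; nia.
Qed.

Lemma laurent_ge_wedge (m n : nat) a b (A : 'M[laurent R]_(m, 2)) (B : 'M_(n, 2)) i j :
  order_ge a A -> order_ge b B -> laurent_ge (a + b) (wedge A B i j).
Proof.
move=> Aa Bb; rewrite wedgeE; apply: laurent_geD; last apply: laurent_geN.
  by apply: laurent_geM; [exact: Aa | exact: Bb].
by apply: laurent_geM; [exact: Aa | exact: Bb].
Qed.

                                                                               
(** A Plücker relation. It bounds the order of the determinant of [x] and [y] from their
    determinants against a basis [v], [v']. *)
Lemma wedge_plucker (v v' x y : 'rV[R]_2) :
  \det (rows2 v v') * wedge x y 0 0 =
  wedge x v' 0 0 * wedge v y 0 0 - wedge x v 0 0 * wedge v' y 0 0.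
Proof. by rewrite det_rows2 !wedgeE; ring. Qed.

Lemma wedge_row (m n : nat) (A : 'M[R]_(m, 2)) (B : 'M_(n, 2)) i j :
  wedge (row i A) (row j B) 0 0 = wedge A B i j.
Proof. by rewrite !wedgeE !mxE. Qed.

Definition dg a b : 'M[laurent R]_2 :=
  rows2 (row2 (lmonomial R a) 0) (row2 0 (lmonomial R b)).

Lemma wedge_dg a b c d (A B : 'M[laurent R]_2) i j :
  wedge (dg a b *m A) (dg c d *m B) i j =
  lmonomial R ((if i == 0 then a else b) + (if j == 0 then c else d)) * wedge A B i j.
Proof.
rewrite !wedgeE !rows2_mul !row2_mul !mxE -monomialD.
by have [->|->] := ord2P i; have [->|->] := ord2P j => /=; ring.
Qed.

(** The diagonal exponents alone settle three of the four entries; only the entry (0, 0) constrains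
    [A] and [B]. *)
Lemma order_ge_wedge_dg n a b c d (A B : 'M[laurent R]_2) :
  order_ge 0 A -> order_ge 0 B -> n <= a + d -> n <= b + c -> n <= b + d ->
  laurent_ge (n - a - c) (wedge A B 0 0) ->
  order_ge n (wedge (dg a b *m A) (dg c d *m B)).
Proof.
move=> A0 B0 ad bc bd W i j; rewrite wedge_dg; apply: laurent_ge_monomial.
have W0 k l : laurent_ge 0 (wedge A B k l).
  by rewrite -[0]addr0; exact: laurent_ge_wedge.
have [->|->] := ord2P i; have [->|->] := ord2P j => /=.
- by rewrite opprD addrA.
- by apply: laurent_geW (W0 _ _); lia.
- by apply: laurent_geW (W0 _ _); lia.
- by apply: laurent_geW (W0 _ _); lia.
Qed.

End LaurentGe.

Lemma det_wedge (R : comPzRingType) (A B : 'M[R]_2) :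
  \det (wedge A B) = \det A * \det B.
Proof. by rewrite det2E !wedgeE !det2E; ring. Qed.

Variables (p r m : nat) (E : fieldType).
Hypothesis p_gt1 : (1 < p)%N.
Let p_gt0 : (0 < p)%N. Proof. exact: ltnW. Qed.
Implicit Types (s : 'I_r -> nat) (G : 'I_r -> 'M[laurent E]_2).

Notation subst := (laurent_subst p).

Definition std s G i : 'M[laurent E]_2 := diag2 E m (s i) *m G i.

Lemma subst_diag2 n : map_mx subst (diag2 E m n) = dg E (p%:Z * n%:Z) (p%:Z * (m%:Z - n%:Z)).
Proof.
have s0 : subst (0 : laurent E) = 0 by exact: (raddf0 (laurent_subst p)).
apply/matrixP => i j; rewrite !mxE.
by have [->|->] := ord2P i; have [->|->] := ord2P j; rewrite ?s0 ?monomial_subst.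
Qed.

Lemma special_subst A : special A -> special (map_mx subst A : 'M[laurent E]_2).
Proof.
move=> [A0 detA]; split; first by rewrite -(mulr0 p%:Z); exact: order_ge_subst.
have : \det (map_mx subst A) = subst (\det A).
  by rewrite !det2E !mxE (raddfB (laurent_subst p)) /= !laurent_substM.
by rewrite detA laurent_subst1.
Qed.

(** The entries to be bounded are powers of u times the entries of the matrix of determinants
    between phi(G_i) and G_{i+1}, which itself has determinant 1. If s_{i+1} exceeded p s_i, the
    bounds would make its whole first row divisible by u, which is impossible. *)
Lemma valid_stdP s G : (forall i, (s i).*2 <= m)%N -> (forall i, special (G i)) ->
  valid_family p m (std s G) <->
  forall i, (s (ordS i) <= p * s i)%N /\
    laurent_ge (m%:Z - p%:Z * (s i)%:Z - (s (ordS i))%:Z)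
      (wedge (map_mx subst (G i)) (G (ordS i)) 0 0).
Proof.
move=> sm Gs; split=> [val i|H i].
  have [_ _] := val i; have := sm i; have := sm (ordS i).
  rewrite /std map_mx_substM // subst_diag2.
  move: (s i) (s (ordS i)) => a b bm am W.
  have W00 := W 0 0; have W01 := W 0 1.
  rewrite wedge_dg in W00; rewrite wedge_dg in W01.
  have {}W00 := laurent_ge_monomialV W00; have {}W01 := laurent_ge_monomialV W01.
  have {}W00 : laurent_ge (m%:Z - p%:Z * a%:Z - b%:Z)
      (wedge (map_mx subst (G i)) (G (ordS i)) 0 0).
    by apply: laurent_geW W00 => /=; lia.
  split=> //; rewrite leqNgt; apply/negP => ab.
  have [G0 detG] := Gs (ordS i); have [SG0 detSG] := special_subst (Gs i).
  have W0 k l : laurent_ge 0 (wedge (map_mx subst (G i)) (G (ordS i)) k l).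
    by rewrite -[0]addr0; exact: laurent_ge_wedge.
  have := det_wedge (map_mx subst (G i)) (G (ordS i)).
  rewrite detG detSG mulr1 det2E => /laurentP/(_ 0).
  suff : laurent_ge 1 (wedge (map_mx subst (G i)) (G (ordS i)) 0 0 *
     wedge (map_mx subst (G i)) (G (ordS i)) 1 1 -
     wedge (map_mx subst (G i)) (G (ordS i)) 0 1 *
     wedge (map_mx subst (G i)) (G (ordS i)) 1 0).
    by move=> -> // /esym/eqP; rewrite /= oner_eq0.
  apply: laurent_geD; last apply: laurent_geN.
    by apply: laurent_geMr => //; apply: laurent_geW W00; lia.
  by apply: laurent_geMr => //; apply: laurent_geW W01 => /=; lia.
have [ps W] := H i; have [G0 _] := Gs (ordS i); have [SG0 _] := special_subst (Gs i).
have := sm i; have := sm (ordS i) => sm1 sm2.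
split; first by apply: order_ge_std => //; lia.
  exact: det_std.
rewrite /std map_mx_substM // subst_diag2; apply: order_ge_wedge_dg => //.
- by move: ps; move: (s i) (s (ordS i)) => a b; nia.
- by move: sm1 sm2; move: (s i) (s (ordS i)) => a b; nia.
- by move: sm1 sm2; move: (s i) (s (ordS i)) => a b; nia.
Qed.

(** Left multiplication by SL_2(E[[u]]) changes the basis and keeps its span. *)
Lemma family_equiv B B' :
  (forall i, exists2 U, special U & B i = U *m B' i) ->
  (forall i, order_ge 0 (B' i)) -> valid_family p m B ->
  valid_family p m B' /\ lattice_of B = lattice_of (B' : 'I_r -> 'M[laurent E]_2).
Proof.
move=> BU B'0 val.
have B'U i : exists2 U, special U & B' i = U *m B i.
  have [U Us ->] := BU i; exists (\adj U); first exact: special_adj.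
  by rewrite mulmxA adj2_mul ?mul1mx //; case: Us.
split.
  move=> i; have [B0 detB Bw] := val i; split=> //.
    by have [U [_ detU] ->] := B'U i; rewrite det_mulmx detU mul1r.
  have [U Us ->] := B'U i; have [U' [U'0 _] ->] := B'U (ordS i).
  rewrite map_mx_substM // wedgeMl wedgeMr.
  apply: order_ge_mul0l; first by case: (special_subst Us).
  by apply: order_ge_mul0r => //; exact: order_ge_tr.
rewrite predeqE => x; split=> xB i; have [c c0 ->] := xB i.
  have [U [U0 _] ->] := BU i; exists (c *m U); last by rewrite mulmxA.
  exact: order_ge_mul0l.
have [U [U0 _] ->] := B'U i; exists (c *m U); last by rewrite mulmxA.
exact: order_ge_mul0l.
Qed.

(** The span of diag(u^s, u^{m-s}) G depends on G only through its first row, taken as a point of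
    the projective line over E[u]/(u^{m-2s}). *)
Lemma std_equiv s G G' :
  (forall i, (s i).*2 <= m)%N ->
  (forall i, special (G i)) -> (forall i, special (G' i)) ->
  (forall i, laurent_ge (m%:Z - (s i).*2%:Z) (wedge (G i) (G' i) 0 0)) ->
  valid_family p m (std s G) ->
  valid_family p m (std s G') /\ lattice_of (std s G) = lattice_of (std s G').
Proof.
move=> sm Gs G's W; apply: family_equiv => i; last first.
  by apply: order_ge_std => //; have := sm i; lia.
have [G0 _] := Gs i; have [G'0 _] := G's i; have smi := sm i.
have detG := det_std m (s i) (Gs i); have detG' := det_std m (s i) (G's i).
have [|U U0 GU] := proj1 (@row_spanP E m 2 (std s G i) _ detG').
  apply: order_ge_wedge_dg => //; rewrite ?subrKC ?subrK //; first by lia.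
  by apply: laurent_geW (W i); lia.
(* Both bases have determinant u^m, so the transition matrix has determinant 1. *)
exists U => //; split=> //; have := congr1 (fun X => \det X * lmonomial E (- m%:Z)) GU.
by rewrite [\det (U *m _)]det_mulmx [\det (std s G i)]detG [\det (std s G' i)]detG'
  -mulrA monomialK mulr1.
Qed.

Lemma gr_lattice_std e (M : set (etale_module r E)) : (p.-1 * m = e)%N ->
  gr_lattice p e M ->
  exists s, exists G, [/\ forall i, ((s i).*2 <= m)%N, forall i, special (G i),
    valid_family p m (std s G) & M = lattice_of (std s G)].
Proof.
move=> me /(gr_latticeP p_gt1 me)[B val ->].
have /choice[s /choice[G sG]] : forall i : 'I_r, exists n : nat, exists A,
    [/\ (n.*2 <= m)%N, special A & exists2 U, special U & B i = U *m (diag2 E m n *m A)].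
  by move=> i; have [B0 detB _] := val i; exact: cartan.
have sm i : ((s i).*2 <= m)%N by case: (sG i).
have Gs i : special (G i) by case: (sG i).
have [||valG BE] := @family_equiv B (std s G) _ _ val.
- by move=> i; have [_ _ [U Us BU]] := sG i; exists U.
- by move=> i; apply: order_ge_std => //; have := sm i; lia.
by exists s, G.
Qed.

End Standard.

(** * A vanishing exponent makes the lattice ordinary *)

Section Ordinary.
Local Open Scope ring_scope.
Local Open Scope classical_set_scope.

(** The cyclic successor permutes the indices in a single cycle. *)
Lemma ordS_ind (r : nat) (P : 'I_r -> Prop) i0 :
  P i0 -> (forall i, P i -> P (ordS i)) -> forall i, P i.
Proof.
move=> P0 PS i; have r_gt0 : (0 < r)%N by case: r i {P i0 P0 PS} => [[]|].
have Pn n : P (iter n (@ordS r) i0) by elim: n => //= n; exact: PS.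
have itE n : nat_of_ord (iter n (@ordS r) i0) = ((i0 + n) %% r)%N.
  elim: n => [|n IH] /=; first by rewrite addn0 modn_small.
  by rewrite IH -addn1 modnDml addn1 addnS.
suff -> : i = iter (i + (r - i0)) (@ordS r) i0 by [].
apply/val_inj; rewrite /= itE; have i0r := ltn_ord i0.
rewrite (_ : (i0 + (i + (r - i0)) = i + r)%N); last by lia.
by rewrite modnDr modn_small.
Qed.

Lemma wedge_scale (R : comPzRingType) (a b : R) (x y : 'rV[R]_2) i j :
  wedge (a *: x) (b *: y) i j = a * b * wedge x y i j.
Proof. by rewrite !wedgeE !mxE; ring. Qed.

Lemma wedge_lin (R : comPzRingType) m n (a b : R) (x y : 'M[R]_(m, 2)) (B : 'M_(n, 2)) :
  wedge (a *: x + b *: y) B = a *: wedge x B + b *: wedge y B.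
Proof. by apply/matrixP => i j; rewrite !(wedgeE, mxE); ring. Qed.

Lemma wedge_expand (R : comPzRingType) (v v' x : 'rV[R]_2) :
  wedge v v' 0 0 *: x = wedge x v' 0 0 *: v - wedge x v 0 0 *: v'.
Proof.
apply/rowP => j; rewrite !wedgeE !mxE.
by have [->|->] := ord2P j; ring.
Qed.

Variables (p r m : nat) (E : fieldType).
Hypotheses (p_gt1 : (1 < p)%N) (m_gt0 : (0 < m)%N).
Let p_gt0 : (0 < p)%N. Proof. exact: ltnW. Qed.

Notation T := (tens r E).
Notation frobT := (fun f => laurent_subst p (laurent_map (@tens_frob r E) f)).

Definition const_row (c : 'rV[E]_2) : etale_module r E :=
  \row_l lconst ([ffun=> c 0 l] : T).

Lemma const_row_proj c i : map_mx (lproj i) (const_row c) = map_mx (@lconst E) c.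
Proof.
apply/matrixP => k l; rewrite !mxE; apply/laurentP => n.
by rewrite lprojE /= !ord1; case: ifP => _; rewrite ffunE.
Qed.

Lemma phi_const c : phi p (const_row c) = const_row c.
Proof.
apply: lproj_mx_inj => i; rewrite -(ord_predK i) lproj_phi !const_row_proj.
by apply/matrixP => k l; rewrite !mxE subst_const.
Qed.

Lemma phi_scale (f : laurent T) (x : etale_module r E) :
  phi p (f *: x) = frobT f *: phi p x.
Proof. by apply/matrixP => k l; rewrite !mxE rmorphM /= laurent_substM. Qed.

Lemma power_series_const_row c : order_ge 0 (const_row c).
Proof. by move=> k l; rewrite mxE; exact: power_series_const. Qed.

Definition line (x : etale_module r E) : set (etale_module r E) :=
  [set f *: x | f in [set f | power_series f]].

Lemma line_submodule x : submodule (line x).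
Proof.
split.
- by exists 0; [ | rewrite scale0r].
- move=> _ _ [f f0 <-] [g g0 <-]; exists (f + g); last by rewrite scalerDl.
  exact: power_seriesD.
- move=> a _ a0 [f f0 <-]; exists (a * f); last by rewrite scalerA.
  exact: power_seriesM.
Qed.

Lemma wedge_const_row (c c' : 'rV[E]_2) : \det (rows2 c c') = 1 ->
  wedge (const_row c) (const_row c') 0 0 = 1.
Proof.
move=> detc; apply: lproj_inj => i; rewrite rmorph1 wedgeE rmorphB !rmorphM /= !mxE.
have cE (d : 'rV[E]_2) l : lproj i (lconst ([ffun=> d 0 l] : T)) = lconst (d 0 l).
  by apply/laurentP => n; rewrite lprojE /=; case: ifP => _; rewrite ffunE.
rewrite !cE -!lconst_mul -(lconst1 E) -detc det_rows2.
by apply/laurentP => n /=; case: ifP => _ //; rewrite subrr.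
Qed.

(** A constant row is fixed by phi, so its line is a phi-stable summand generated by its image under
    phi. *)
Lemma ordinary_of_line (M : set (etale_module r E)) (c c' : 'rV[E]_2) :
  \det (rows2 c c') = 1 ->
  M = [set x + y | x in line (const_row c)
        & y in line (lmonomial T m%:Z *: const_row c')] ->
  ordinary p M.
Proof.
move=> detc ->; exists (line (const_row c)), (line (lmonomial T m%:Z *: const_row c')).
have wcc := wedge_const_row detc.
have wc0 (d : 'rV[E]_2) : wedge (const_row d) (const_row d) 0 0 = 0.
  by rewrite wedgeE; ring.
split.
- exists (const_row c); split.
    rewrite predeqE => x; split=> [[f f0 <-]|[a a0 <-]].
      exists f%:M; last by rewrite mul_scalar_mx.
      by move=> k l; rewrite !ord1 mxE.
    exists (a 0 0); first exact: a0.
    by rewrite [in RHS](mx11_scalar a) mul_scalar_mx.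
  move=> a _; rewrite (mx11_scalar a) mul_scalar_mx => /(congr1 (fun x =>
    wedge x (1 *: const_row c') 0 0)).
  rewrite wedge_scale wcc !mulr1 => ->.
  rewrite wedgeE !mxE !mul0r subr0.
  by apply/matrixP => k l; rewrite !mxE mul0rn.
- exact: line_submodule.
- split=> //; rewrite predeqE => x; split=> [[[f f0 <-] [g g0 fg]]|->]; last first.
    by split; [exists 0 | exists 0]; rewrite ?scale0r.
  have : wedge (f *: const_row c) (1 *: const_row c') 0 0 = 0.
    by rewrite -fg scalerA wedge_scale wc0 mulr0.
  by rewrite wedge_scale wcc !mulr1 => ->; rewrite scale0r.
- move=> _ [f f0 <-]; rewrite phi_scale phi_const; exists (frobT f) => //.
  apply: power_series_subst => // t t0; rewrite /= f0 //.
  by rewrite (raddf0 (@tens_frob r E)).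
rewrite eqEsubset; split; last first.
  move=> _ [f f0 <-] P [[P0 PD PZ] Pphi]; apply: PZ => //.
  apply: Pphi; exists (const_row c); last exact: phi_const.
  by exists 1; [exact: power_series1 | rewrite scale1r].
apply: smallest_sub; first exact: line_submodule.
move=> _ [_ [f f0 <-] <-]; rewrite phi_scale phi_const; exists (frobT f) => //.
apply: power_series_subst => // t t0; rewrite /= f0 //.
by rewrite (raddf0 (@tens_frob r E)).
Qed.

Lemma special_mod_u (A : 'M[laurent E]_2) : special A ->
  A 0 0 0 * A 1 1 0 - A 0 1 0 * A 1 0 0 = 1.
Proof.
move=> [A0 detA]; have coef0 (f g : laurent E) : power_series f -> power_series g ->
    (f * g) 0 = f 0 * g 0.
  move=> f0 g0; rewrite -[LHS]/(lconv _ _ _) (lconvE f0 g0 (N := 1)) //.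
  by rewrite big_ord1 addr0.
have /laurentP/(_ 0) := detA; rewrite det2E.
rewrite -[LHS]/((A 0 0 * A 1 1) 0 - (A 0 1 * A 1 0) 0).
by rewrite !coef0; try exact: A0.
Qed.

                                                                                
                                                                                
                                                       
(** From s_{i+1} <= p s_i all exponents vanish, and stability says that the first rows satisfy:
    phi(w_i) and w_{i+1} are proportional modulo u^m. Let c be the value of w_{i0} at u = 0.
    Proportionality of w_i to c modulo u^n propagates to the next index modulo u^{pn}, capped at
    u^m; going round the cycle, every w_i is proportional to c modulo u^m. Hence the lattice is the
    line of c plus u^m times a complementary constant line. *)
Lemma ordinary_std (s : 'I_r -> nat) (G : 'I_r -> 'M[laurent E]_2) i0 :
  (forall i, (s i).*2 <= m)%N -> (forall i, special (G i)) ->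
  valid_family p m (std m s G) -> s i0 = 0%N -> ordinary p (lattice_of (std m s G)).
Proof.
move=> sm Gs val s0; have sval := proj1 (valid_stdP p_gt1 sm Gs) val.
have {s0} s0 i : s i = 0%N.
  apply: (ordS_ind (P := fun i => s i = 0%N) s0) => {}i si.
  by have [+ _] := sval i; rewrite si muln0 leqn0 => /eqP.
pose w i := row 0 (G i); pose c : 'rV[E]_2 := \row_l w i0 0 l 0.
pose ch := map_mx (@lconst E) c.
have w0 i : order_ge 0 (w i) by move=> k l t t0; rewrite mxE; case: (Gs i) => -> .
have ch0 : order_ge 0 ch by move=> k l; rewrite mxE; exact: power_series_const.
have step i (n : nat) : laurent_ge n%:Z (wedge (w i) ch 0 0) ->
    forall n' : nat, (n' <= p * n)%N -> (n' <= m)%N ->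
    laurent_ge n'%:Z (wedge (w (ordS i)) ch 0 0).
  move=> wn n' n'p n'm; have [SG0 detSG] := special_subst p_gt1 (Gs i).
  (* Expand w_{i+1} against c along the rows of phi(G_i). Since c is constant, the determinant of
     phi(w_i) and c is the image under u -> u^p of that of w_i and c, which multiplies its order by
     p; the other term contains the determinant of w_{i+1} and phi(w_i), of order at least m. *)
  have := wedge_plucker (row 0 (map_mx (laurent_subst p) (G i)))
    (row 1 (map_mx (laurent_subst p) (G i))) (w (ordS i)) ch.
  rewrite rows2_row detSG mul1r => ->.
  have rowS l : order_ge 0 (row l (map_mx (laurent_subst p) (G i))).
    by move=> k j t t0; rewrite mxE SG0.
  have W0 (x y : 'rV[laurent E]_2) : order_ge 0 x -> order_ge 0 y -> laurent_ge 0 (wedge x y 0 0).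
    by move=> x0 y0; rewrite -[0]addr0; exact: laurent_ge_wedge.
  apply: laurent_geD.
    apply: laurent_geMl; first exact: W0.
    have -> : wedge (row 0 (map_mx (laurent_subst p) (G i))) ch 0 0 =
        laurent_subst p (wedge (w i) ch 0 0).
      rewrite !wedgeE !mxE (raddfB (laurent_subst p)) /= !laurent_substM //.
      by rewrite !subst_const.
    by apply: laurent_geW (laurent_ge_subst p_gt0 wn); lia.
  apply/laurent_geN/laurent_geMr; last exact: W0.
  have [_] := sval i; rewrite !s0 mulr0 !subr0 -wedge_row => W.
  have -> : wedge (w (ordS i)) (row 0 (map_mx (laurent_subst p) (G i))) 0 0 =
      - wedge (row 0 (map_mx (laurent_subst p) (G i))) (w (ordS i)) 0 0.
    by rewrite !wedgeE; ring.
  by apply/laurent_geN/laurent_geW/W; lia.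
have w1 i : laurent_ge 1 (wedge (w i) ch 0 0).
  apply: (ordS_ind (P := fun i => laurent_ge 1 (wedge (w i) ch 0 0)) _ _ i).
    have coefM (f : laurent E) (d : E) : (f * lconst d) 0 = f 0 * d.
      by rewrite mulrC lconstM mulrC.
    move=> t t1; have [t0|t0] := ltP t 0.
      by apply: (@laurent_ge_wedge E 1 1 0 0 _ _ 0 0 (w0 i0) ch0).
    have -> : t = 0 by lia.
    rewrite wedgeE [ch 0 0]mxE [ch 0 1]mxE.
    rewrite -[LHS]/((w i0 0 0 * lconst (c 0 1)) 0 - (w i0 0 1 * lconst (c 0 0)) 0).
    by rewrite !coefM ![c _ _]mxE mulrC subrr.
  by move=> {}i wi; apply: (step i 1%N wi 1%N); lia.
(* Each step gains at least one order, since p(n+1) >= n+2. *)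
have wm i : laurent_ge m%:Z (wedge (w i) ch 0 0).
  suff H n : (n < m)%N -> forall i, laurent_ge n.+1%:Z (wedge (w i) ch 0 0).
    by have := H m.-1; rewrite prednK // => /(_ (leqnn m)).
  elim: n => [|n IH] nm j; first exact: w1.
  rewrite -(ord_predK j); apply: (step _ n.+1); [apply: IH; lia | | exact: nm].
  by nia.
have G1 := special_mod_u (Gs i0).
have [c' detc] : exists c' : 'rV[E]_2, \det (rows2 c c') = 1.
  exists (\row_l G i0 1 l 0); rewrite det_rows2 !mxE -G1.
  by rewrite mulrC [in X in _ - X]mulrC; ring.
have chE i : map_mx (lproj i) (const_row c) = ch by exact: const_row_proj.
apply: (ordinary_of_line detc).
(* This places c in every component, by Cramer's rule. *)
have cB i : order_ge m%:Z (wedge ch (std m s G i)).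
  have W k l : wedge ch (std m s G i) k l =
      if l == 0 then - wedge (w i) ch 0 0 else lmonomial E m%:Z * wedge ch (row 1 (G i)) 0 0.
    rewrite /std diag2_mul s0 subr0 monomial0 scale1r !wedgeE !mxE.
    by have [->|->] := ord2P l; rewrite /=; ring.
  move=> k l; rewrite W; case: ifP => _; first exact: laurent_geN (wm i).
  apply: laurent_ge_monomial; rewrite subrr -[0]addr0; apply: laurent_ge_wedge => //.
  by move=> k' l' t t0; rewrite mxE; case: (Gs i) => ->.
have B0 i : order_ge 0 (std m s G i) by case: (val i).
rewrite predeqE => x; split=> [xM|[_ [f f0 <-] [_ [g g0 <-] <-]]]; last first.
  apply/(mem_lattice_of val) => i.
  rewrite scalerA map_mxD !map_mxZ /= !const_row_proj wedge_lin.
  apply: order_geD.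
    by apply: order_ge_power_series; [exact: lproj_power_series | exact: cB].
  rewrite rmorphM /= lproj_monomial -scalerA.
  apply: order_ge_power_series; first exact: lproj_power_series.
  apply: (@order_geW _ (m%:Z + 0)); first by rewrite addr0.
  apply: order_ge_monomial => k l.
  rewrite -/(laurent_ge 0 _) -[0]addr0; apply: laurent_ge_wedge => // k' j.
  by rewrite mxE; exact: power_series_const.
have x0 : order_ge 0 x.
  apply/lproj_order => i; have [d d0 ->] := xM i; exact: order_ge_mul0l.
(* The coordinates of [x] in the basis c, c' are given by [wedge_expand]; the second one is
   divisible by u^m because both [x] and c lie in a lattice of determinant u^m. *)
exists (wedge x (const_row c') 0 0 *: const_row c).
  exists (wedge x (const_row c') 0 0) => //.
  rewrite /power_series -/(laurent_ge 0 _) -[0]addr0; apply: laurent_ge_wedge => //.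
  exact: power_series_const_row.
exists (- wedge x (const_row c) 0 0 *: const_row c').
  exists (lmonomial T (- m%:Z) * - wedge x (const_row c) 0 0); last first.
    by rewrite scalerA mulrAC monomialKV mul1r.
  apply: laurent_ge_monomial; rewrite sub0r opprK; apply: laurent_geN.
  have : order_ge m%:Z (wedge x (const_row c)).
    apply/lproj_order => i; have [d d0 xi] := xM i.
    have -> : map_mx (lproj i) (wedge x (const_row c)) = wedge (map_mx (lproj i) x) ch.
      by apply/matrixP => k l; rewrite mxE !wedgeE rmorphB !rmorphM /= -(chE i) !mxE.
    rewrite xi wedgeMl; apply: order_ge_mul0l => //.
    by rewrite -[wedge _ _]trmxK wedge_tr; apply/order_ge_tr/order_geN/cB.
  exact.
by rewrite scaleNr -wedge_expand (wedge_const_row detc) scale1r.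
Qed.

End Ordinary.

                                              

(** * Points of projective space and their specialisations *)

Section Points.
Local Open Scope ring_scope.
Local Open Scope classical_set_scope.
Variables (n : nat).

Lemma map_meval (R S : comNzRingType) (g : {rmorphism R -> S}) (a : 'I_n -> S)
    (f : {mpoly R[n]}) : (map_mpoly g f).@[a] = mmap g a f.
Proof.
rewrite [in LHS](mpolyE f) (raddf_sum (map_mpoly g)) (raddf_sum (meval a)).
by apply: eq_bigr => m _ /=; rewrite map_mpolyZ map_mpolyX mevalZ mevalX.
Qed.

Lemma mmap_homog (R S : comNzRingType) (g : {rmorphism R -> S}) (a : 'I_n -> S) c d
    (f : {mpoly R[n]}) : f \is d.-homog ->
  mmap g (fun i => c * a i) f = c ^+ d * mmap g a f.
Proof.
move=> /dhomogP fd; rewrite /mmap mulr_sumr !big_seq; apply: eq_bigr => m mf.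
rewrite /mmap1; under eq_bigr do rewrite exprMn.
by rewrite big_split /= prodrXr -mdegE fd // mulrCA.
Qed.

Lemma rmorph_mmap (R S S' : comNzRingType) (g : {rmorphism R -> S})
    (g' : {rmorphism R -> S'}) (h : {rmorphism S -> S'}) a a' (f : {mpoly R[n]}) :
  (forall x, h (g x) = g' x) -> (forall i, h (a i) = a' i) ->
  h (mmap g a f) = mmap g' a' f.
Proof.
move=> hg ha; rewrite rmorph_sum; apply: eq_bigr => m _.
rewrite rmorphM hg rmorph_prod; congr (_ * _); apply: eq_bigr => i _.
by rewrite rmorphXn ha.
Qed.

Lemma proj_pointP (F F' : fieldType) (j : {rmorphism F -> F'}) (a : 'I_n -> F')
    (a0 : exists i, a i != 0) f :
  proj_ideal (proj_point j a0) f <-> forall d, mmap j a (pihomog mdeg d f) = 0.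
Proof.
rewrite -[proj_ideal _ f]/(vanishing_ideal j a f).
by split=> af d; [rewrite -map_meval | rewrite map_meval]; exact: af.
Qed.

Lemma proj_closure (F : fieldType) (x y : proj n F) :
  closure [set x] y <-> proj_ideal x `<=` proj_ideal y.
Proof.
split=> [xy f xf|xy U].
  apply: contrapT => yf.
  have /xy[_ [->]] : nbhs y [set z : proj n F | ~ proj_ideal z f].
    apply: open_nbhs_nbhs; split=> //; apply/zariski_openP => z zf.
    by exists f.
  by [].
rewrite nbhsE => -[V [oV Vy] VU]; exists x; split=> //; apply: VU.
have /zariski_openP/(_ y Vy)[f yf fV] := oV.
by apply: fV => /xy.
Qed.

End Points.

(** * Plücker coordinates as maximal minors *)

Section Minors.
Local Open Scope ring_scope.
Local Open Scope classical_set_scope.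
Variable N : nat.

(** Indexed like [plucker], but computed from the given rows instead of a chosen [row_base]; it
    therefore makes sense over any commutative ring and commutes with base change. *)
Definition minor (R : comPzRingType) (q : nat) (A : 'M[R]_(q, N)) (s : 'I_#|{set 'I_N}|) : R :=
  let S : {set 'I_N} := enum_val s in
  if #|S| =P q is ReflectT eqS then \det (mxsub (cast_ord eqS) enum_val A) else 0.

Lemma minor_map (R R' : comPzRingType) (f : {rmorphism R -> R'}) q (A : 'M_(q, N)) s :
  minor (map_mx f A) s = f (minor A s).
Proof.
by rewrite /minor; case: eqP => [eqS|_]; rewrite ?rmorph0 // -det_map_mx map_mxsub.
Qed.

Lemma minor_mul (R : comPzRingType) q (U : 'M[R]_q) (A : 'M_(q, N)) s :
  minor (U *m A) s = \det U * minor A s.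
Proof.
rewrite /minor; case: eqP => [eqS|_]; last by rewrite mulr0.
move: eqS (@enum_val _ (mem (enum_val s))); move: #|enum_val s| => l eqS g.
case: q / eqS U A => U A; rewrite mxsub_mul -det_mulmx; congr (\det (_ *m _)).
  by apply/matrixP => i k; rewrite !mxE; congr (U _ _); exact: val_inj.
by apply/matrixP => i k; rewrite !mxE; congr (A _ _); exact: val_inj.
Qed.

(** Two bases of the same row space differ by an invertible matrix; [c] is its determinant. *)
Lemma plucker_minor (E : fieldType) l q (A : 'M[E]_(l, N)) (R : 'M_(q, N)) :
  row_free R -> (A :=: R)%MS ->
  exists2 c, c != 0 & forall s, plucker A s = c * minor R s.
Proof.
move=> /eqP rR AR; have rA : \rank A = q by rewrite AR.
case: q / rA R rR AR => R rR AR.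
have AR' : (row_base A :=: R)%MS by apply: eqmx_trans AR; exact: eq_row_base.
have /submxP[U AU] : (row_base A <= R)%MS by rewrite AR'.
exists (\det U); last by move=> s; rewrite -minor_mul -AU.
have rU : row_free U.
  by rewrite /row_free -(mxrankMfree U (introT eqP rR)) -AU eq_row_base.
by move: rU; rewrite row_free_unit unitmxE unitfE.
Qed.

End Minors.

(** * Lines in a Grassmannian are connected *)

Section Pencil.
Local Open Scope ring_scope.
Local Open Scope classical_set_scope.

                                                  
Lemma finite_nonroot (F : finFieldType) (Q : {poly F}) : Q != 0 ->
  exists (F' : finFieldType) (j : {rmorphism F -> F'}) (t : F'), (map_poly j Q).[t] != 0.
Proof.
move=> Q0; pose T := 'X * Q + 1.
have sT : (1 < size T)%N.
  rewrite /T mulrC size_MXaddC (negPf Q0) /= ltnS lt0n size_poly_eq0 //.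
have T0 : T != 0 by rewrite -size_poly_gt0 ltnW.
have [L [zs Tzs _]] := FinSplittingFieldFor T0.
case: zs Tzs => [|t zs] Tzs.
  by have := eqp_size Tzs; rewrite big_nil size_map_poly size_poly1 => s1; rewrite s1 in sT.
have Tt : root (map_poly (in_alg L) T) t.
  by rewrite (eqp_root Tzs) big_cons rootM root_XsubC eqxx.
exists (finvect_type L), (in_alg L), t.
apply/eqP => Qt; move: Tt; rewrite rootE rmorphD rmorphM rmorph1 /= map_polyX.
by rewrite hornerD hornerM Qt mulr0 add0r hornerC oner_eq0.
Qed.

Lemma pencil_row_free (F : fieldType) (q N : nat) (K : 'M[F]_(q, N)) (a b : 'rV[F]_N) t :
  row_free (col_mx K (col_mx a b)) -> row_free (col_mx K (a + t *: b)).
Proof.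
move=> Kab; apply: inj_row_free => v; rewrite -[v]hsubmxK mul_row_col => v0.
have : row_mx (lsubmx v) (row_mx (rsubmx v) (t *: rsubmx v)) *m col_mx K (col_mx a b) = 0.
  rewrite !mul_row_col -[RHS]v0 mulmxDr; congr (_ + (_ + _)).
  by rewrite -scalemxAl -scalemxAr.
rewrite -[X in _ = X](mul0mx _ (col_mx K (col_mx a b))) => /(row_free_inj Kab).
rewrite -[0]hsubmxK => /eq_row_mx[-> ]; rewrite -[rsubmx 0]hsubmxK => /eq_row_mx[-> _].
by rewrite !linear0 row_mx0.
Qed.

Variables (F F' : finFieldType) (j : {rmorphism F -> F'}).
Variables (q N : nat) (K : 'M[F']_(q, N)) (a b : 'rV[F']_N).
Hypothesis Kab : row_free (col_mx K (col_mx a b)).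

(** The subspaces K + <a + t b> form a line in the Grassmannian. The base ring is arbitrary so that
    t can also be the indeterminate of F'[X]. *)
Definition pencil (R : comPzRingType) (g : {rmorphism F' -> R}) (t : R) : 'M[R]_(q + 1, N) :=
  col_mx (map_mx g K) (map_mx g a + t *: map_mx g b).

Lemma map_pencil (R S : comPzRingType) (g : {rmorphism F' -> R}) (g' : {rmorphism F' -> S})
    (h : {rmorphism R -> S}) t : (forall x, h (g x) = g' x) ->
  map_mx h (pencil g t) = pencil g' (h t).
Proof.
move=> hg; rewrite /pencil map_col_mx map_mxD map_mxZ -!map_mx_comp.
by congr col_mx; [|congr (_ + _ *: _)]; apply/matrixP => k l; rewrite !mxE /= hg.
Qed.

Lemma row_free_pencil (F'' : fieldType) (g : {rmorphism F' -> F''}) t : row_free (pencil g t).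
Proof. by apply: pencil_row_free; rewrite -!map_col_mx row_free_map. Qed.

Let P := minor (pencil (@polyC F') 'X).
Let ev (F'' : fieldType) (g : {rmorphism F' -> F''}) (t : F'') : {rmorphism {poly F'} -> F''} :=
  horner_eval t \o map_poly g.

Let evC (F'' : fieldType) (g : {rmorphism F' -> F''}) t x : ev g t x%:P = g x.
Proof. by rewrite /= /horner_eval map_polyC hornerC. Qed.

Let evP (F'' : fieldType) (g : {rmorphism F' -> F''}) t s :
  ev g t (P s) = minor (pencil g t) s.
Proof.
rewrite /P -minor_map; congr (minor _ s); rewrite (map_pencil (g' := g)); last exact: evC.
by rewrite /= /horner_eval map_polyX hornerX.
Qed.

(** Coordinates of the generic point of the line: the minors at t = X, over the fraction field of
    F'[X]. *)
Let a_eta s : {fraction {poly F'}} := tofrac (P s).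
Let j_eta : {rmorphism F -> {fraction {poly F'}}} := @tofrac _ \o (@polyC F' \o j).

Let eta_neq0 : exists s, a_eta s != 0.
Proof.
have R0 := row_free_pencil (@idfun F') 0.
have [c c0 cP] := plucker_minor R0 (eqmx_refl _).
have [s] := plucker_neq0 (pencil (@idfun F') 0); rewrite cP mulf_eq0 negb_or => /andP[_ Ps].
exists s; rewrite tofrac_eq0; apply: contraNneq Ps => Ps0.
by rewrite -evP Ps0 rmorph0.
Qed.

Let eta := proj_point j_eta eta_neq0.

Let etaP f : proj_ideal eta f <->
  forall d, mmap (@polyC F' \o j) P (pihomog mdeg d f) = 0.
Proof.
split=> [/proj_pointP ef|ef]; [|apply/proj_pointP] => d.
  apply/eqP; rewrite -tofrac_eq0; apply/eqP; rewrite -[RHS](ef d).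
  exact: rmorph_mmap.
have := congr1 (@tofrac _) (ef d); rewrite rmorph0 => <-.
by apply/esym; exact: rmorph_mmap.
Qed.

(** The coordinates of a member of the pencil are, up to a common scalar, the values at t of the
    generic ones, so its ideal is read off by specialising X to t. *)
Let pointP (F'' : fieldType) (g : {rmorphism F' -> F''}) (jg : {rmorphism F -> F''}) t l
    (A : 'M[F'']_(l, N)) f : (forall x, jg x = g (j x)) -> (A :=: pencil g t)%MS ->
  proj_ideal (proj_point jg (plucker_neq0 A)) f <->
  forall d, ev g t (mmap (@polyC F' \o j) P (pihomog mdeg d f)) = 0.
Proof.
move=> jgE AE; have [c c0 cP] := plucker_minor (row_free_pencil g t) AE.
have E d : mmap jg (plucker A) (pihomog mdeg d f) =
    c ^+ d * ev g t (mmap (@polyC F' \o j) P (pihomog mdeg d f)).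
  rewrite (_ : plucker A = fun s => c * minor (pencil g t) s); last exact/funext.
  rewrite (mmap_homog jg _ c (pihomogP _ d f)); congr (_ * _); apply/esym.
  by apply: rmorph_mmap => [x|s]; [rewrite jgE -(evC g t) | exact: evP].
split=> [/proj_pointP H d|H].
  by have := H d; rewrite E => /eqP; rewrite mulf_eq0 expf_eq0 (negPf c0) andbF => /eqP.
by apply/proj_pointP => d; rewrite E H mulr0.
Qed.

                                                                               
                                                      
(** The closure of the generic point [eta] is connected and contains every member of the pencil over
    F'. It lies in the closed set [S] as soon as [eta] does, and [eta] is a limit of the members
    over finite extensions of F'. *)
Lemma pencil_component (S : set (proj #|{set 'I_N}| F)) : closed S ->
  (forall (F'' : finFieldType) (g : {rmorphism F' -> F''}) (jg : {rmorphism F -> F''}) t,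
    (forall x, jg x = g (j x)) ->
    exists l, exists2 A : 'M[F'']_(l, N), (A :=: pencil g t)%MS &
      S (proj_point jg (plucker_neq0 A))) ->
  forall t0 t1 l0 l1 (A0 : 'M_(l0, N)) (A1 : 'M_(l1, N)),
    (A0 :=: pencil idfun t0)%MS -> (A1 :=: pencil idfun t1)%MS ->
  connected_component S (proj_point j (plucker_neq0 A0)) (proj_point j (plucker_neq0 A1)).
Proof.
move=> clS Spencil t0 t1 l0 l1 A0 A1 A0E A1E.
have Seta : S eta.
  apply: clS => U; rewrite nbhsE => -[V [oV Ve] VU].
  have /zariski_openP/(_ _ Ve)[f ef fV] := oV.
  (* A basic open set around [eta] is given by some [f] whose value along the pencil is a nonzero
     polynomial; a non-root of it in a finite extension gives a member of the pencil in that open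
     set. *)
  have [d Q0] : exists d, mmap (@polyC F' \o j) P (pihomog mdeg d f) != 0.
    apply: contrapT => /forallNP H; apply: ef; apply/etaP => d.
    by have /negP/negPn/eqP := H d.
  have [F'' [g [t Qt]]] := finite_nonroot Q0.
  have [l [A AE SA]] := Spencil F'' g (g \o j) t (fun=> erefl).
  exists (proj_point (g \o j) (plucker_neq0 A)); split=> //; apply: VU; apply: fV.
  have gj x : (g \o j) x = g (j x) by [].
  by move/(proj1 (pointP f gj AE))/(_ d)/eqP; rewrite (negPf Qt).
have sub l t (A : 'M_(l, N)) : (A :=: pencil idfun t)%MS ->
    closure [set eta] (proj_point j (plucker_neq0 A)).
  move=> AE; apply/proj_closure => f /etaP ef.
  have jE x : j x = idfun (j x) by [].
  by apply: (proj2 (pointP f jE AE)) => d; rewrite ef rmorph0.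
exists (closure [set eta]); last exact: sub A1E.
split; [exact: sub A0E | | exact/connected_closure/connected1].
by rewrite (closure_id S).1 //; apply: closure_subset => _ ->.
Qed.

End Pencil.

(** * Linear algebra in M_0 / u^e M_0 *)

Section Window.
Local Open Scope ring_scope.
Local Open Scope classical_set_scope.
Variables (r e : nat).
Notation window := ('I_r * 'I_2 * 'I_e)%type.
Notation N := #|{: window}|.

Section Coordinates.
Variable E : comPzRingType.
Implicit Types (x y : etale_module r E) (D : 'I_r -> 'M[laurent E]_2).

Lemma truncationE x s : truncation e x 0 s =
  (x 0 (enum_val s : window).1.2 (nat_of_ord (enum_val s : window).2)%:Z
    : tens r E) (enum_val s : window).1.1.
Proof. by rewrite mxE; case: (enum_val s) => [[i l] n]. Qed.

Lemma truncationD x y : truncation e (x + y) = truncation e x + truncation e y :> 'rV_N.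
Proof. by apply/rowP => s; rewrite [RHS]mxE !truncationE mxE /= ffunE. Qed.

Lemma truncationB x y : truncation e (x - y) = truncation e x - truncation e y :> 'rV_N.
Proof.
by apply/rowP => s; rewrite truncationE [RHS]mxE [X in _ = _ + X]mxE !truncationE
  [(x - y) _ _]mxE [(- y) _ _]mxE /= !ffunE.
Qed.

Lemma truncation_eq0 x : order_ge 0 x -> truncation e x = 0 :> 'rV_N -> order_ge e%:Z x.
Proof.
move=> x0 xt k l t te; rewrite (ord1 k); have [/x0 -> //|t0] := ltP t 0.
have te' : (absz t < e)%N by lia.
apply/ffunP => i; have /rowP/(_ (enum_rank ((i, l, Ordinal te') : window))) := xt.
rewrite truncationE enum_rankK [RHS]mxE /= ffunE => <-.
by congr (x 0 l _ i); lia.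
Qed.

(** Multiplication by [D] on M_0 / u^e M_0: block diagonal in i and Toeplitz in the exponent. For
    integral [D] its row space is the image of [lattice_of D]. *)
Definition window_mx D : 'M[E]_N :=
  \matrix_(s, s') let: (i, l, n) := (enum_val s : window) in
    let: (i', l', n') := (enum_val s' : window) in
    if i == i' then D i l l' ((nat_of_ord n')%:Z - (nat_of_ord n)%:Z) else 0.

Lemma truncation_glue (c : 'I_r -> 'rV[laurent E]_2) s :
  truncation e (glue_mx c) 0 s =
  c (enum_val s : window).1.1 0 (enum_val s : window).1.2 (nat_of_ord (enum_val s : window).2)%:Z.
Proof. by rewrite truncationE mxE /= ffunE. Qed.

Lemma truncation_mul (c : 'I_r -> 'rV[laurent E]_2) D :
  (forall i, order_ge 0 (c i)) -> (forall i, order_ge 0 (D i)) ->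
  truncation e (glue_mx (fun i => c i *m D i)) =
  truncation e (glue_mx c) *m window_mx D.
Proof.
move=> c0 D0; apply/rowP => s'; rewrite [RHS]mxE truncation_glue.
under eq_bigr => s _ do rewrite truncation_glue [window_mx D _ _]mxE.
case: (enum_val s') => [[i' l'] n'] /=.
pose G i l (n : 'I_e) := c i 0 l (nat_of_ord n)%:Z *
  (if i == i' then D i l l' ((nat_of_ord n')%:Z - (nat_of_ord n)%:Z) else 0).
transitivity (\sum_(x : window) G x.1.1 x.1.2 x.2); last first.
  rewrite (reindex _ (onW_bij _ (enum_val_bij _))) /=; apply: eq_bigr => s _; rewrite /G.
  by case: (enum_val s) => [[i l] n].
rewrite -(pair_bigA _ (fun q n => G q.1 q.2 n)) -(pair_bigA _ (fun i l => \sum_n G i l n)) /=.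
rewrite (bigD1 i') //= [X in _ + X]big1 ?addr0 => [|i /negPf ii']; last first.
  by rewrite big1 // => l _; rewrite big1 // => n _; rewrite /G ii' mulr0.
rewrite mxE laurent_sumE; apply: eq_bigr => l _; rewrite -[LHS]/(lconv _ _ _).
rewrite (lconvE (c0 i' 0 l) (D0 i' l l') (N := e)); last by have := ltn_ord n'; lia.
by apply: eq_bigr => n _; rewrite /G eqxx add0r.
Qed.

Lemma truncation_surj (v : 'rV[E]_N) : exists2 c : 'I_r -> 'rV[laurent E]_2,
  forall i, order_ge 0 (c i) & truncation e (glue_mx c) = v.
Proof.
exists (fun i => \row_l \sum_(n < e)
    lmonomial E (nat_of_ord n)%:Z * lconst (v 0 (enum_rank ((i, l, n) : window)))).
  move=> i k l t t0; rewrite mxE laurent_sumE big1 // => n _.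
  by rewrite monomialM /= lt_eqF //; lia.
apply/rowP => s; rewrite truncation_glue -[in RHS](enum_valK s).
case: (enum_val s) => [[i l] n] /=; rewrite mxE laurent_sumE (bigD1 n) //=.
rewrite [X in X + _]monomialM /= subrr eqxx big1 ?addr0 // => n' nn'.
rewrite [LHS]monomialM /= subr_eq0 eqz_nat ifF //.
by apply: contraNF nn' => /eqP nn; apply/eqP/val_inj.
Qed.

End Coordinates.

Lemma map_window_mx (R S : comPzRingType) (f : {rmorphism R -> S}) D :
  map_mx f (window_mx D) = window_mx (fun i => map_mx (laurent_map f) (D i)).
Proof.
apply/matrixP => s s'; rewrite !mxE.
case: (enum_val s) (enum_val s') => [[i l] n] [[i' l'] n'].
by case: ifP => _; rewrite ?rmorph0 // !mxE.
Qed.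

Lemma window_mxP (E : fieldType) (D : 'I_r -> 'M[laurent E]_2) v :
  (forall i, order_ge 0 (D i)) ->
  (v <= window_mx D)%MS <-> exists2 x, lattice_of D x & truncation e x = v.
Proof.
move=> D0; split=> [/submxP[w ->]|[x Dx <-]].
  have [c c0 <-] := truncation_surj w.
  exists (glue_mx (fun i => c i *m D i)); last by rewrite truncation_mul.
  by move=> i; rewrite glue_mxK; exists (c i).
have /choice[c cP] : forall i, exists c : 'rV_2,
    order_ge 0 c /\ map_mx (lproj i) x = c *m D i.
  by move=> i; have [c] := Dx i; exists c.
have -> : x = glue_mx (fun i => c i *m D i).
  by apply: lproj_mx_inj => i; rewrite glue_mxK (cP i).2.
by rewrite truncation_mul ?submxMl // => i; case: (cP i).
Qed.

Lemma truncation_mxP (E : finFieldType) (M : set (etale_module r E)) l (W : 'M[E]_(l, N)) :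
  (forall v : 'rV_N, (v <= W)%MS <-> exists2 x, M x & truncation e x = v) ->
  (truncation_mx e M :=: W)%MS.
Proof.
move=> WM; apply/eqmxP/andP; split; apply/row_subP => s.
  rewrite rowK; have := enum_valP s; rewrite inE => /asboolP[x Mx <-].
  by apply/WM; exists x.
have /WM[x Mx xs] := row_sub s W.
have vW : row s W \in finset (fun v => `[< exists2 x, M x & truncation e x = v >]).
  by rewrite inE; apply/asboolP; exists x.
rewrite (_ : row s W = row (enum_rank_in vW (row s W)) (truncation_mx e M)) ?row_sub //.
by rewrite rowK enum_rankK_in.
Qed.

End Window.

(** * Base change of coefficients *)

Section BaseChange.
Local Open Scope ring_scope.
Variables (R S : comPzRingType) (g : {rmorphism R -> S}).

Lemma laurent_map_subst p f :
  laurent_map g (laurent_subst p f) = laurent_subst p (laurent_map g f).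
Proof. by apply/laurentP => n /=; case: ifP; rewrite ?rmorph0. Qed.

Lemma laurent_map_monomial n : laurent_map g (lmonomial R n) = lmonomial S n.
Proof. by apply/laurentP => t; rewrite /= rmorph_nat. Qed.

Lemma order_ge_map a (m n : nat) (A : 'M[laurent R]_(m, n)) :
  order_ge a A -> order_ge a (map_mx (laurent_map g) A).
Proof. by move=> Aa i j t ta; rewrite mxE /= Aa ?rmorph0. Qed.

Lemma map_wedge (m n : nat) (A : 'M[laurent R]_(m, 2)) (B : 'M[laurent R]_(n, 2)) :
  wedge (map_mx (laurent_map g) A) (map_mx (laurent_map g) B) =
  map_mx (laurent_map g) (wedge A B).
Proof. by apply/matrixP => i j; rewrite [RHS]mxE !wedgeE rmorphB !rmorphM !mxE. Qed.

Lemma map_mx_subst p (m n : nat) (A : 'M[laurent R]_(m, n)) :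
  map_mx (laurent_subst p) (map_mx (laurent_map g) A) =
  map_mx (laurent_map g) (map_mx (laurent_subst p) A).
Proof. by apply/matrixP => i j; rewrite !mxE laurent_map_subst. Qed.

End BaseChange.

(** * Adjacent lattices and the pencil between them *)

Section Adjacent.
Local Open Scope ring_scope.
Local Open Scope classical_set_scope.
Variables (p r m e : nat) (F F' : finFieldType) (j : {rmorphism F -> F'}).
Hypotheses (p_gt1 : (1 < p)%N) (r_gt1 : (1 < r)%N) (me : (p.-1 * m = e)%N).
Let p_gt0 : (0 < p)%N. Proof. exact: ltnW. Qed.

Variables (B B' : 'I_r -> 'M[laurent F']_2) (i0 : 'I_r) (a b : 'rV[laurent F']_2).
Hypotheses (Bval : valid_family p m B) (B'val : valid_family p m B').
Hypothesis B'E : forall i, i != i0 -> B' i = B i.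
Hypothesis Bi0 : B i0 = rows2 a (lmonomial F' 1 *: b).
Hypothesis B'i0 : B' i0 = rows2 (lmonomial F' 1 *: a) b.

Let row_order (R : comPzRingType) n (x y : 'rV[laurent R]_2) : order_ge n (rows2 x y) ->
  order_ge n x /\ order_ge n y.
Proof.
move=> xy; split=> k l t tn; rewrite (ord1 k).
  by have := xy 0 l t tn; rewrite mxE.
by have := xy 1 l t tn; rewrite mxE.
Qed.

Let a0 : order_ge 0 a.
Proof. by have [+ _ _] := Bval i0; rewrite Bi0 => /row_order[]. Qed.

Let b0 : order_ge 0 b.
Proof. by have [+ _ _] := B'val i0; rewrite B'i0 => /row_order[]. Qed.

Let detY : \det (rows2 a b) = lmonomial F' (m%:Z - 1).
Proof.
have [_ + _] := Bval i0; rewrite Bi0 !det_rows2 !mxE => detB.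
rewrite addrC -monomialD -detB -[LHS]mul1r -(monomialKV F' 1); ring.
Qed.

Let ordS_neq (i : 'I_r) : ordS i != i.
Proof.
apply/eqP => /(congr1 val) /=; have ir := ltn_ord i.
have [ir'|ir'] := ltnP i.+1 r; first by rewrite modn_small //; lia.
by rewrite (_ : i.+1 = r); [rewrite modnn | ]; lia.
Qed.

                                                                                
                                                         
(** At [i0] the rows are a + t(b - a) and u(b - a), which span <a + t(b - a)> + uY for Y = <a, b>.
    The matrix in front has determinant u, whatever t is. *)
Definition pencil_family (R : comPzRingType) (g : {rmorphism F' -> R}) (t : R) (i : 'I_r) :
    'M[laurent R]_2 :=
  if i == i0 then
    rows2 (row2 (1 - lconst t) (lconst t)) (row2 (- lmonomial R 1) (lmonomial R 1)) *m
      map_mx (laurent_map g) (rows2 a b)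
  else map_mx (laurent_map g) (B i).

(** Since r > 1, the neighbours of [i0] keep their components. The image of the preceding component
    lies in both given lattices at [i0], so in uY, which every member contains; and every member is
    contained in Y, which phi maps into the following component. *)
Lemma pencil_family_valid (R : comPzRingType) (g : {rmorphism F' -> R}) (t : R) :
  valid_family p m (pencil_family g t).
Proof.
have P0 : order_ge 0 (rows2 (row2 (1 - lconst t) (lconst t))
    (row2 (- lmonomial R 1) (lmonomial R 1))).
  apply: order_ge_rows2; apply: power_series_row2.
  - apply: power_seriesD; first exact: power_series1.
    exact/power_seriesN/power_series_const.
  - exact: power_series_const.
  - exact/power_seriesN/(power_series_monomial _ 1).
  - exact: (power_series_monomial _ 1).
have neq i : i != i0 -> pencil_family g t i = map_mx (laurent_map g) (B i).
  by rewrite /pencil_family => /negPf ->.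
have Ei0 : pencil_family g t i0 = rows2 (row2 (1 - lconst t) (lconst t))
    (row2 (- lmonomial R 1) (lmonomial R 1)) *m map_mx (laurent_map g) (rows2 a b).
  by rewrite /pencil_family eqxx.
move=> i; have [->|ii0] := eqVneq i i0.
  rewrite Ei0 (neq _ (ordS_neq i0)).
  split.
  - by apply: order_ge_mul0l => //; apply: order_ge_map; exact: order_ge_rows2.
  - rewrite det_mulmx det_rows2 !mxE /= (det_map_mx (laurent_map g)) detY /= laurent_map_monomial.
    rewrite (_ : lmonomial R m%:Z = lmonomial R 1 * lmonomial R (m%:Z - 1)); last first.
      by rewrite monomialD addrC subrK.
    ring.
  rewrite map_mx_substM // wedgeMl; apply: order_ge_mul0l.
    by rewrite -(mulr0 p%:Z); exact: order_ge_subst.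
  rewrite map_mx_subst map_wedge; apply: order_ge_map => k l s sm.
  have [_ _ W] := Bval i0; have [_ _ W'] := B'val i0.
  (* The row [a] belongs to [B i0] and [b] to [B' i0], so each bound comes from one of the two valid
     families. *)
  have [k0|k1] := ord2P k.
    have := W 0 l s sm; rewrite Bi0 !wedgeE k0 !mxE /=; exact.
  have := W' 1 l s sm; rewrite B'i0 (B'E (ordS_neq i0)) !wedgeE k1 !mxE /=; exact.
rewrite (neq _ ii0); have [Bo detB W] := Bval i; have [_ _ W'] := B'val i.
split; first exact: order_ge_map.
  by rewrite (det_map_mx (laurent_map g)) detB /= laurent_map_monomial.
have [Si|Si] := eqVneq (ordS i) i0; last first.
  by rewrite (neq _ Si) map_mx_subst map_wedge; exact: order_ge_map.
rewrite Si Ei0 wedgeMr; apply: order_ge_mul0r; last exact: order_ge_tr.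
rewrite map_mx_subst map_wedge; apply: order_ge_map => k l s sm.
(* Again [a] is read in [B i0] and [b] in [B' i0]. As Y has determinant u^{m-1}, order m against
   both rows means membership in uY. *)
have [l0|l1] := ord2P l.
  have := W k 0 s sm; rewrite Si Bi0 !wedgeE l0 !mxE /=; exact.
have := W' k 1 s sm; rewrite Si B'i0 (B'E ii0) !wedgeE l1 !mxE /=; exact.
Qed.

Let delta_mx_i0 (R : comPzRingType) (y : 'rV[laurent R]_2) : etale_module r R :=
  glue_mx (fun i => if i == i0 then y else 0).
(** The intersection of the two lattices, with uY at [i0]. *)
Let D i := if i == i0 then lmonomial F' 1 *: rows2 a b else B i.
Let av : 'rV[F']_#|{: 'I_r * 'I_2 * 'I_e}| := truncation e (delta_mx_i0 a).
Let bv : 'rV[F']_#|{: 'I_r * 'I_2 * 'I_e}| := truncation e (delta_mx_i0 (b - a)).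
Let K := row_base (window_mx e D).

Let D0 i : order_ge 0 (D i).
Proof.
rewrite /D; case: ifP => _; last by case: (Bval i).
apply: (@order_geW _ (1 + 0)) => //; apply: order_ge_monomial.
exact: order_ge_rows2.
Qed.

Let delta_order (R : comPzRingType) n (y : 'rV[laurent R]_2) :
  order_ge n y -> order_ge n (delta_mx_i0 y).
Proof.
move=> yn; apply/lproj_order => i; rewrite glue_mxK; case: ifP => // _.
exact: order_ge0.
Qed.

Let delta_lin (R : comPzRingType) (c d : R) (x y : 'rV[laurent R]_2) :
  truncation e (delta_mx_i0 (lconst c *: x + lconst d *: y)) =
  c *: truncation e (delta_mx_i0 x) + d *: truncation e (delta_mx_i0 y).
Proof.
apply/rowP => s; rewrite [RHS]mxE [in RHS]mxE [X in _ = _ + X]mxE !truncation_glue.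
case: ifP => _; rewrite !mxE ?mulr0 ?addr0 //.
rewrite -[LHS]/((lconst c * _) _ + (lconst d * _) _).
by rewrite !lconstM.
Qed.

(** If y = c a + d(b - a) is congruent modulo u^e to an element x of the intersection, then y - x
    lies in u^e M_0, hence in both lattices, and so y is in uY. Its coordinates c - d and d in the
    basis a, b are constants divisible by u, so they vanish. *)
Lemma lattice_pencil_rank : row_free (col_mx K (col_mx av bv)).
Proof.
apply: inj_row_free => v; rewrite -[v]hsubmxK -[rsubmx v]hsubmxK.
set v1 := lsubmx v; set v2 := lsubmx (rsubmx v); set v3 := rsubmx (rsubmx v).
rewrite !mul_row_col => v0.
suff [v20 v30] : v2 = 0 /\ v3 = 0.
  move: v0; rewrite v20 v30 !mul0mx !addr0 -[0](mul0mx _ K).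
  by move/(row_free_inj (row_base_free _)) => ->; rewrite !row_mx0.
pose c := v2 0 0; pose d := v3 0 0.
pose y := lconst c *: a + lconst d *: (b - a).
have y0 : order_ge 0 y.
  by apply: order_geD; apply: order_ge_power_series;
    rewrite ?power_series_const //; try exact: power_series_const;
    apply: order_geD => //; exact: order_geN.
have [x Dx xt] : exists2 x, lattice_of D x & truncation e x = truncation e (delta_mx_i0 y).
  apply/(window_mxP _ D0); rewrite delta_lin -!mul_scalar_mx -!mx11_scalar.
  have /eqP := v0; rewrite addrC addr_eq0 => /eqP ->.
  by rewrite -mulNmx; apply: submx_trans (submxMl _ K) _; rewrite eq_row_base.
have [f0 f00 fx] := Dx i0.
have x0 : order_ge 0 x.
  by apply/lproj_order => i; have [f ? ->] := Dx i; exact: order_ge_mul0l.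
have zB A : valid_family p m A -> lattice_of A (delta_mx_i0 y - x).
  move=> Aval; have latA := valid_gr_lattice p_gt1 Aval me.
  have ze : order_ge e%:Z (delta_mx_i0 y - x).
    apply: truncation_eq0; last by rewrite truncationB xt subrr.
    by apply: order_geD; [exact: delta_order | exact: order_geN].
  rewrite -[_ - x]scale1r -(monomialK _ e%:Z) -scalerA.
  apply: (gr_lattice_window p_gt1 latA).
  by have := order_ge_monomial (n := - e%:Z) ze; rewrite addNr.
have [c1 c10 z1] := zB _ Bval i0; have [c2 c20 z2] := zB _ B'val i0.
(* Compare the coordinates in Y of the [i0]-component of y - x, read once in <a, u b> and once in <u
   a, b>: both are divisible by u. *)
have c12 : row2 (c1 0 0) (lmonomial _ 1 * c1 0 1) = row2 (lmonomial _ 1 * c2 0 0) (c2 0 1).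
  apply: (cancel_det detY); rewrite !row2_rows2.
  have row2E (w : 'rV[laurent F']_2) : w = row2 (w 0 0) (w 0 1).
    by apply/rowP => l; rewrite mxE; have [->|->] := ord2P l.
  have := z2; rewrite z1 Bi0 B'i0 (row2E c1) (row2E c2) !row2_rows2 !mxE /= !scalerA.
  by rewrite ![_ * lmonomial _ _]mulrC.
have yE : row2 (lconst c - lconst d) (lconst d) = lmonomial _ 1 *:
    (row2 (c2 0 0) (c1 0 1) + f0).
  apply: (cancel_det detY).
  have -> : row2 (lconst c - lconst d) (lconst d) *m rows2 a b = y.
    by rewrite row2_rows2 /y; apply/rowP => l; rewrite !mxE; ring.
  have : map_mx (lproj i0) (delta_mx_i0 y - x + x) = y.
    by rewrite subrK glue_mxK eqxx.
  rewrite map_mxD fx z1 {1}/D eqxx => <-.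
  rewrite -scalemxAl mulmxDl scalerDr -scalemxAr; congr (_ + _).
  have c100 : c1 0 0 = lmonomial _ 1 * c2 0 0 by have /rowP/(_ 0) := c12; rewrite !mxE.
  by rewrite Bi0; apply/rowP => l; rewrite mulmx2E !mxE !big_ord_recl big_ord0 !mxE /= c100; ring.
have cd0 l : (row2 (lconst c - lconst d) (lconst d)) 0 l 0 = 0.
  rewrite yE mxE monomialM; apply: (@order_geD _ 0) => //.
  by apply: power_series_row2; [exact: c20 | exact: c10].
have dz : d = 0 by have := cd0 1; rewrite mxE.
have cz : c = 0 by have := cd0 0; rewrite mxE /= dz subr0.
by rewrite [v2]mx11_scalar [v3]mx11_scalar -/c -/d cz dz !raddf0.
Qed.

Let delta_scale (R : comPzRingType) (c : R) (x : 'rV[laurent R]_2) :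
  truncation e (delta_mx_i0 (lconst c *: x)) = c *: truncation e (delta_mx_i0 x).
Proof. by have := delta_lin c 0 x 0; rewrite scaler0 scale0r !addr0. Qed.

Let delta_map (R : comPzRingType) (g : {rmorphism F' -> R}) (x : 'rV[laurent F']_2) :
  truncation e (delta_mx_i0 (map_mx (laurent_map g) x)) =
  map_mx g (truncation e (delta_mx_i0 x)).
Proof.
apply/rowP => s; rewrite truncation_glue [RHS]mxE truncation_glue.
by case: ifP => _; rewrite !mxE //= rmorph0.
Qed.

(** The member at t is generated by the intersection of the two lattices and the single vector y = a
    + t(b - a) over the coefficient field, since u y already lies in uY. *)
Lemma pencil_window (F'' : finFieldType) (g : {rmorphism F' -> F''}) t :
  (truncation_mx e (lattice_of (pencil_family g t)) :=: pencil K av bv g t)%MS.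
Proof.
pose c : laurent F'' := lconst t; pose u := lmonomial F'' 1.
pose A := map_mx (laurent_map g) (rows2 a b).
pose Dg i := map_mx (laurent_map g) (D i).
pose y := map_mx (laurent_map g) a + c *: map_mx (laurent_map g) (b - a).
pose Pt := rows2 (row2 (1 - c) c) (row2 (- u) u).
have Dg0 i : order_ge 0 (Dg i) by exact: order_ge_map.
have Dgi0 : Dg i0 = u *: A.
  by rewrite /Dg /D eqxx map_mxZ /= laurent_map_monomial.
have Ei0 : pencil_family g t i0 = Pt *m A by rewrite /pencil_family eqxx.
have Ei i : i != i0 -> pencil_family g t i = Dg i.
  by rewrite /pencil_family /Dg /D => /negPf ->.
have yE : y = row2 1 0 *m (Pt *m A).
  rewrite mulmxA row2_mul scale1r scale0r addr0; apply/rowP => l.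
  rewrite mulmx2E !mxE /= [laurent_map g (b 0 l - a 0 l)]rmorphB; ring.
have yt : truncation e (delta_mx_i0 y) = map_mx g av + t *: map_mx g bv.
  by rewrite -!delta_map -[X in X + _]scale1r -delta_lin lconst1 scale1r.
have u0 : power_series u by exact: (power_series_monomial _ 1).
have c0 : power_series c by exact: power_series_const.
have p1 := @power_series1 F''.
have KE : (map_mx g K :=: window_mx e Dg)%MS.
  rewrite -map_window_mx; apply/eqmxP.
  by rewrite !map_submx; apply/andP; split; rewrite eq_row_base.
apply: truncation_mxP => v; split=> [/submxP[w ->]|[x xM <-]].
  rewrite -[w]hsubmxK mul_row_col -yt [rsubmx w]mx11_scalar mul_scalar_mx -delta_scale.
  have [x xD <-] : exists2 x, lattice_of Dg x & truncation e x = lsubmx w *m map_mx g K.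
    by apply/(window_mxP _ Dg0); apply: submx_trans (submxMl _ _) _; rewrite KE.
  rewrite -truncationD; eexists; last reflexivity.
  move=> i; have [f f0 xi] := xD i; rewrite map_mxD xi glue_mxK.
  have [->|ii0] := eqVneq i i0; last first.
    by exists f; rewrite // addr0 Ei.
  (* The inner rows express u a and u b in the basis y, u(b - a): u a = u y - t u(b - a) and u b = u
     y + (1 - t) u(b - a). *)
  exists (f *m rows2 (row2 u (- c)) (row2 u (1 - c)) + row2 (lconst (rsubmx w 0 0)) 0).
    apply: order_geD; last by apply: power_series_row2 => //; exact: power_series_const.
    apply: order_ge_mul0l => //; apply: order_ge_rows2; apply: power_series_row2 => //.
      exact: power_seriesN.
    by apply: power_seriesD => //; exact: power_seriesN.
  rewrite Ei0 Dgi0 mulmxDl yE !mulmxA; congr (_ + _).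
    by apply/rowP => l; rewrite !mulmx2E !mxE /=; ring.
  have rowZ (k : laurent F'') : row2 k 0 = k *: row2 1 0.
    by apply/rowP => l; rewrite !mxE; case: ifP; rewrite ?mulr1 ?mulr0.
  by rewrite (rowZ (lconst _)) -!scalemxAl.
have [f f0 xi0] := xM i0; have [f1 f10 f1E] := const_mod_u (f0 0 0).
set alpha := f 0 0 0 in f1E.
rewrite (_ : x = x - delta_mx_i0 (lconst alpha *: y) + delta_mx_i0 (lconst alpha *: y)); last first.
  by rewrite subrK.
rewrite truncationD delta_scale yt /pencil -addsmxE; apply: addmx_sub_adds; last exact: scalemx_sub.
rewrite KE; apply/(window_mxP _ Dg0); eexists; last reflexivity.
move=> i; rewrite map_mxB glue_mxK.
have [->|ii0] := eqVneq i i0; last first.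
  by have [h h0 ->] := xM i; exists h; rewrite // subr0 Ei.
(* After removal of the constant multiple [alpha] of y there remains f1 u y + (f 0 1) u(b - a),
   written here in the basis u a, u b. *)
exists (row2 (f1 * (1 - c) - f 0 1) (f1 * c + f 0 1)).
  apply: power_series_row2.
    by apply: power_seriesD; [apply: power_seriesM => //; apply: power_seriesD => // |];
      apply: power_seriesN => //; exact: f0.
  by apply: power_seriesD; [apply: power_seriesM | exact: f0].
rewrite xi0 Ei0 Dgi0 yE -scalemxAr !scalemxAl -mulmxBl mulmxA; congr (_ *m A).
apply/rowP => l; rewrite mulmx2E !mxE /= f1E -/u.
by have [->|->] := ord2P l; rewrite /=; ring.
Qed.

Let pencil_endpoints :
  lattice_of (pencil_family idfun (0 : F')) = lattice_of B /\
  lattice_of (pencil_family idfun (1 : F')) = lattice_of B'.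
Proof.
have mapid k l (A : 'M[laurent F']_(k, l)) : map_mx (laurent_map idfun) A = A.
  by apply/matrixP => s t; rewrite mxE; apply/laurentP.
have p0 : power_series (0 : laurent F') by [].
have p1 := @power_series1 F'.
have u0 : power_series (lmonomial F' 1) := @power_series_monomial F' 1.
have special1 : special (1%:M : 'M[laurent F']_2).
  split; last exact: det1.
  by move=> k l; rewrite mxE; case: (k == l).
have c0 : lconst (0 : F') = 0 by apply/laurentP => n /=; case: ifP.
split.
  have [||_ //] := @family_equiv p r m F' p_gt1 _ B _ _ (pencil_family_valid idfun 0) => i;
    last by case: (Bval i).
  rewrite /pencil_family; case: eqVneq => [->|_]; last first.
    by exists 1%:M => //; rewrite mapid mul1mx.
  (* At t = 0 the pencil basis is a, u(b - a), compared with a, u b. *)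
  exists (rows2 (row2 1 0) (row2 (- lmonomial F' 1) 1)).
    split; last by rewrite det_rows2 !mxE /=; ring.
    by apply: order_ge_rows2; apply: power_series_row2 => //; exact: power_seriesN.
  rewrite mapid Bi0 c0; apply/matrixP => k l; rewrite !mulmx2E !mxE /=.
  by have [->|->] := ord2P k; rewrite /=; ring.
have [||_ //] := @family_equiv p r m F' p_gt1 _ B' _ _ (pencil_family_valid idfun 1) => i;
  last by case: (B'val i).
rewrite /pencil_family; case: eqVneq => [->|ii0]; last first.
  by exists 1%:M => //; rewrite mapid mul1mx B'E.
(* At t = 1 it is b, u(b - a), compared with u a, b. *)
exists (rows2 (row2 0 1) (row2 (-1) (lmonomial F' 1))).
  split; last by rewrite det_rows2 !mxE /=; ring.
  by apply: order_ge_rows2; apply: power_series_row2 => //; exact: power_seriesN.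
rewrite mapid B'i0 lconst1; apply/matrixP => k l; rewrite !mulmx2E !mxE /=.
by have [->|->] := ord2P k; rewrite /=; ring.
Qed.

Lemma adjacent_component :
  connected_component (gr_space p r e F) (gr_point e j (lattice_of B))
    (gr_point e j (lattice_of B')).
Proof.
have [E0 E1] := pencil_endpoints; rewrite -E0 -E1.
apply: (pencil_component lattice_pencil_rank _ _
  (pencil_window idfun 0) (pencil_window idfun 1)).
  exact: closed_closure.
move=> F'' g jg t jgE; eexists; eexists; first exact: (pencil_window g t).
apply: subset_closure; exists F'', jg, (lattice_of (pencil_family g t)); split=> //.
exact: (valid_gr_lattice p_gt1 (pencil_family_valid g t) me).
Qed.

End Adjacent.

                                            

(** * Chains of pencils to a standard lattice *)

Section Chain.
Local Open Scope ring_scope.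
Local Open Scope classical_set_scope.
Variables (p r m e : nat) (F F' : finFieldType) (j : {rmorphism F -> F'}).
Hypotheses (p_gt1 : (1 < p)%N) (r_gt1 : (1 < r)%N) (me : (p.-1 * m = e)%N).
Hypothesis m_gt1 : (1 < m)%N.
Implicit Types (s : 'I_r -> nat) (G : 'I_r -> 'M[laurent F']_2).

Definition joined (M M' : set (etale_module r F')) : Prop :=
  connected_component (gr_space p r e F) (gr_point e j M) (gr_point e j M').

Lemma joined_refl B : valid_family p m B -> joined (lattice_of B) (lattice_of B).
Proof.
move=> Bval; apply/connected_component_refl/subset_closure.
by exists F', j, (lattice_of B); split=> //; exact: (valid_gr_lattice p_gt1 Bval me).
Qed.

Lemma joined_trans M M' M'' : joined M M' -> joined M' M'' -> joined M M''.
Proof. exact: connected_component_trans. Qed.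

Lemma joined_sym M M' : joined M M' -> joined M' M.
Proof. exact: connected_component_sym. Qed.

Lemma std_split s G i0 : std m s G i0 =
  rows2 (lmonomial F' (s i0)%:Z *: row 0 (G i0))
    (lmonomial F' 1 *: (lmonomial F' (m%:Z - (s i0)%:Z - 1) *: row 1 (G i0))).
Proof.
rewrite /std diag2_mul scalerA monomialD.
by rewrite (_ : 1 + (m%:Z - (s i0)%:Z - 1) = m%:Z - (s i0)%:Z) // addrC subrK.
Qed.

(** Raising the exponent s by one shrinks the gap m - 2s between the two elementary divisors. *)
Definition shrink s i0 i := if i == i0 then (s i).+1 else s i.

(** With g_0, g_1 the rows of [G i0], take a = u^s g_0 and b = u^{m-s-1} g_1 for s = [s i0]: the two
    lattices are <a, u b> and <u a, b> at [i0]. *)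
Lemma joined_shrink s G i0 : valid_family p m (std m s G) ->
  valid_family p m (std m (shrink s i0) G) ->
  joined (lattice_of (std m s G)) (lattice_of (std m (shrink s i0) G)).
Proof.
move=> val val'; apply: (adjacent_component j p_gt1 r_gt1 me val val' _ (std_split s G i0)).
  by move=> i /negPf ii0; rewrite /std /shrink ii0.
rewrite /std /shrink eqxx diag2_mul scalerA monomialD.
rewrite (_ : 1 + (s i0)%:Z = (s i0).+1%:Z); last by rewrite -add1n PoszD.
by rewrite (_ : m%:Z - (s i0).+1%:Z = m%:Z - (s i0)%:Z - 1) // -addn1 PoszD opprD addrA.
Qed.

Let h := m./2.
Let h2 : (h.*2 <= m)%N. Proof. by rewrite -[leqRHS]odd_double_half leq_addl. Qed.
Let h_gt0 : (0 < h)%N. Proof. by rewrite half_gt0. Qed.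
Let m2 : (m <= h.*2.+1)%N.
Proof. by rewrite -[leqLHS]odd_double_half -add1n leq_add2r leq_b1. Qed.

Lemma std_half_valid G : (forall i, special (G i)) -> valid_family p m (std m (fun=> h) G).
Proof.
move=> Gs; apply/(valid_stdP p_gt1) => // i; split; first by rewrite leq_pmull // ltnW.
(* The required order m - (p+1)h is at most 0, because (p+1)h >= 3h >= 2h+1 >= m. *)
apply: (@laurent_geW _ _ 0); first by move: h_gt0 m2; nia.
rewrite -[0]addr0; apply: laurent_ge_wedge; last by case: (Gs (ordS i)).
by case: (special_subst p_gt1 (Gs i)).
Qed.

(** Raise [s] at an index where it is minimal, by induction on the total distance to h. Stability
    survives: s_{i0} + 1 <= s_i + 1 <= p s_i because s_i >= 1 and p >= 2, and the orders demanded of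
    the determinants only decrease. *)
Lemma joined_half s G : (forall i, 0 < s i <= h)%N -> (forall i, special (G i)) ->
  valid_family p m (std m s G) ->
  joined (lattice_of (std m s G)) (lattice_of (std m (fun=> h) G)).
Proof.
move=> + Gs; have [n] := ubnP (\sum_i (h - s i))%N.
elim: n s => // n IH s sn sh val.
have [[j0 j0h]|sE] := pselect (exists j0, (s j0 < h)%N); last first.
  suff -> : s = (fun=> h); first exact: joined_refl (std_half_valid Gs).
  apply/funext => i; apply/eqP; rewrite eqn_leq; have /andP[_ ->] /= := sh i.
  by rewrite leqNgt; apply/negP => ih; apply: sE; exists i.
have [i0 _ imin] := @arg_minnP _ j0 xpredT s isT.
have si0h : (s i0 < h)%N by apply: leq_ltn_trans j0h; exact: imin.
have sh' i : (0 < shrink s i0 i <= h)%N.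
  by rewrite /shrink; case: eqP => [->|_]; rewrite ?si0h ?sh.
have val' : valid_family p m (std m (shrink s i0) G).
  apply/(valid_stdP p_gt1) => // i.
    by apply: leq_trans h2; rewrite leq_double; case/andP: (sh' i).
  have sm k : ((s k).*2 <= m)%N.
    by apply: leq_trans h2; rewrite leq_double; case/andP: (sh k).
  have [ps W] := proj1 (valid_stdP p_gt1 sm Gs) val i.
  have s_gt0 : (0 < s i)%N by case/andP: (sh i).
  have imin' := imin i isT; rewrite /shrink; split.
    have [Si|_] := eqVneq (ordS i) i0; last first.
      by case: eqP => _ //; apply: leq_trans ps _; rewrite leq_mul2l leqnSn orbT.
    by rewrite Si; case: eqP => _; move: p_gt1 imin' s_gt0; nia.
  apply: laurent_geW W; case: eqP => _; case: eqP => _; nia.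
apply: joined_trans (joined_shrink val val') _; apply: IH => //.
have : (\sum_i (h - shrink s i0 i) < \sum_i (h - s i))%N; last by move: sn; lia.
rewrite (bigD1 i0) //= [X in (_ < X)%N](bigD1 i0) //= /shrink eqxx.
rewrite -addSn leq_add //; first by lia.
by apply: leq_sum => i /negPf ->.
Qed.

Definition straighten G i0 i : 'M[laurent F']_2 := if i == i0 then 1%:M else G i.

Let special1 : special (1%:M : 'M[laurent F']_2).
Proof.
split; last exact: det1.
by move=> k l; rewrite mxE; case: (k == l); first exact: power_series1.
Qed.

Lemma special_straighten G i0 : (forall i, special (G i)) ->
  forall i, special (straighten G i0 i).
Proof. by move=> Gs i; rewrite /straighten; case: ifP. Qed.

Let half_equiv G G' : (forall i, special (G i)) -> (forall i, special (G' i)) ->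
  (forall i, laurent_ge (m%:Z - h.*2%:Z) (wedge (G i) (G' i) 0 0)) ->
  lattice_of (std m (fun=> h) G) = lattice_of (std m (fun=> h) G').
Proof.
move=> Gs G's W.
by have [] := std_equiv p_gt1 (fun=> h2) Gs G's W (std_half_valid Gs).
Qed.

Let wedge_same (A : 'M[laurent F']_2) : wedge A A 0 0 = 0.
Proof. by rewrite wedgeE; ring. Qed.

(** When the upper right entry of [G i0] has order at least m - 2h, the lattices for [G i0] and for
    the identity coincide. Otherwise m = 2h + 1 and this entry is a unit; the two lattices at [i0]
    are then given by two distinct points of the projective line over the residue field, and a
    pencil joins them. *)
Lemma joined_straighten G i0 : (forall i, special (G i)) ->
  joined (lattice_of (std m (fun=> h) G)) (lattice_of (std m (fun=> h) (straighten G i0))).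
Proof.
move=> Gs; have G's := special_straighten i0 Gs.
have W i : wedge (G i) (straighten G i0 i) 0 0 = if i == i0 then - G i0 0 1 else 0.
  rewrite /straighten; case: eqP => [->|_]; last exact: wedge_same.
  by rewrite wedgeE !mxE /=; ring.
have [G0 _] := Gs i0.
have [W0|W0] := pselect (laurent_ge (m%:Z - h.*2%:Z) (G i0 0 1)).
  rewrite (half_equiv Gs G's); first exact: joined_refl (std_half_valid G's).
  by move=> i; rewrite W; case: eqP => // _; exact: laurent_geN.
have mE : m = h.*2.+1.
  apply/eqP; rewrite eqn_leq m2 ltn_neqAle h2 andbT; apply/eqP => hm.
  by apply: W0; rewrite -{1}hm subrr; exact: G0.
have G010 : G i0 0 1 0 != 0.
  apply/eqP => G010; apply: W0 => t; rewrite mE => tm.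
  by have [/G0 //|t0] := ltP t 0; rewrite (_ : t = 0) //; lia.
have [g g0 Gg] := power_series_inv (G0 0 1) G010.
have p0 : power_series (0 : laurent F') by [].
have u0 : power_series (lmonomial F' 1) := @power_series_monomial F' 1.
(* Only the first row matters, so the second may be chosen as a unit multiple of the first standard
   basis vector; g is the inverse of the upper right entry, which gives determinant 1. *)
pose H i := if i == i0 then rows2 (row 0 (G i0)) (row2 (- g) 0) else G i.
have Hs i : special (H i).
  rewrite /H; case: ifP => // _; split; last by rewrite det_rows2 !mxE /= -Gg; ring.
  apply: order_ge_rows2; last by apply: power_series_row2 => //; exact: power_seriesN.
  by move=> k l; rewrite mxE; exact: G0.
have Hi0 : H i0 = rows2 (row 0 (G i0)) (row2 (- g) 0) by rewrite /H eqxx.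
rewrite (half_equiv Gs Hs); last first.
  move=> i; rewrite (_ : wedge _ _ 0 0 = 0) //.
  rewrite /H; case: eqP => [->|_]; last exact: wedge_same.
  by rewrite wedgeE !mxE /=; ring.
pose a := lmonomial F' h%:Z *: row 0 (H i0).
pose b := lmonomial F' (m%:Z - h%:Z - 1) *: row 1 (H i0).
pose B' i := if i == i0 then rows2 (lmonomial F' 1 *: a) b else std m (fun=> h) (straighten G i0) i.
have mh : m%:Z - h%:Z - 1 = h%:Z by rewrite mE; lia.
have [B'val ->] : valid_family p m B' /\
    lattice_of (std m (fun=> h) (straighten G i0)) = lattice_of B'.
  apply: (family_equiv p_gt1) (std_half_valid G's) => i; rewrite /B'.
    case: eqP => [->|_]; last by exists 1%:M; rewrite ?mul1mx.
    (* This expresses u^h times the first standard vector and u^{h+1} times the second in the basis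
       u a, b; here a = u^h w for the first row w of [G i0], and b = u^h (-g, 0). *)
    exists (rows2 (row2 0 (- G i0 0 1)) (row2 g (lmonomial F' 1 * G i0 0 0))).
      split; last by rewrite det_rows2 !mxE /= -Gg; ring.
      apply: order_ge_rows2; apply: power_series_row2 => //.
        exact/power_seriesN/G0.
      by apply: power_seriesM => //; exact: G0.
    rewrite /std /straighten eqxx mulmx1 /a /b mh.
    apply/matrixP => k l; rewrite !mulmx2E !mxE /= (_ : m%:Z - h%:Z = 1 + h%:Z); last by lia.
    rewrite -monomialD.
    have Gg1 x : x = x * (G i0 0 1 * g) by rewrite Gg mulr1.
    rewrite Hi0 !mxE /=.
    by have [->|->] := ord2P k; have [->|->] := ord2P l; rewrite /= [LHS]Gg1; ring.
  case: eqP => _; last by case: (std_half_valid G's i).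
  have row0 l : order_ge 0 (row l (H i0)).
    by case: (Hs i0) => H0 _ k l'; rewrite mxE; exact: H0.
  rewrite /a /b mh; apply: order_ge_rows2.
    by do 2!apply: order_ge_power_series => //; exact: power_series_monomial.
  by apply: order_ge_power_series => //; exact: power_series_monomial.
apply: (adjacent_component j p_gt1 r_gt1 me (std_half_valid Hs) B'val _ (std_split _ H i0)).
  by move=> i /negPf ii0; rewrite /B' /std /straighten /H ii0.
by rewrite /B' eqxx.
Qed.

(** The matrices are straightened one index at a time; [Gn n] is the identity at the first n
    indices. *)
Lemma joined_trivial G : (forall i, special (G i)) ->
  joined (lattice_of (std m (fun=> h) G)) (lattice_of (std m (fun=> h) (fun=> 1%:M))).
Proof.
move=> Gs; pose Gn n (i : 'I_r) : 'M[laurent F']_2 := if (i < n)%N then 1%:M else G i.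
have Gns n i : special (Gn n i) by rewrite /Gn; case: ifP.
have step n : (n <= r)%N ->
    joined (lattice_of (std m (fun=> h) G)) (lattice_of (std m (fun=> h) (Gn n))).
  elim: n => [|n IH] nr; first exact: joined_refl (std_half_valid Gs).
  apply: joined_trans (IH (ltnW nr)) _.
  suff <- : straighten (Gn n) (Ordinal nr) = Gn n.+1 by exact: joined_straighten.
  apply/funext => i; rewrite /straighten /Gn -val_eqE /= ltnS [(i <= n)%N]leq_eqVlt.
  by case: eqP.
have := step r (leqnn r); rewrite (_ : Gn r = fun=> 1%:M) //.
by apply/funext => i; rewrite /Gn ltn_ord.
Qed.

Lemma half_joined s G : (forall i, (s i).*2 <= m)%N -> (forall i, 0 < s i)%N ->
  (forall i, special (G i)) -> valid_family p m (std m s G) ->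
  joined (lattice_of (std m s G)) (lattice_of (std m (fun=> h) (fun=> 1%:M))).
Proof.
move=> sm s_gt0 Gs val; apply: joined_trans (joined_trivial Gs); apply: joined_half => // i.
by rewrite s_gt0 geq_half_double sm.
Qed.

End Chain.

Lemma nonordinary_std (p r m e : nat) (E : fieldType) (M : set (etale_module r E)) :
  1 < p -> 0 < m -> p.-1 * m = e -> gr_lattice p e M -> ~ ordinary p M ->
  exists s, exists G, [/\ forall i, (s i).*2 <= m, forall i, 0 < s i,
    forall i, special (G i), valid_family p m (std m s G) & M = lattice_of (std m s G)].
Proof.
move=> p_gt1 m_gt0 me /(gr_lattice_std p_gt1 me)[s [G [sm Gs val ->]]] nord.
exists s, G; split=> // i; rewrite lt0n; apply/eqP => si.
by apply: nord; exact: (ordinary_std p_gt1 m_gt0 sm Gs val si).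
Qed.

Theorem proposition2p3
    (p r e : nat) (k F F' : finFieldType)
    (k_F : {rmorphism k -> F}) (F_F' : {rmorphism F -> F'})
    (p_prime : prime p) (p_gt2 : 2 < p)
    (card_k : #|k| = p ^ r) (k_neq_Fp : #|k| <> p)
    (e_gt0 : 0 < e) (e_dvd : p.-1 %| e)
    (M1 M2 : set (etale_module r F')) :
  gr_lattice p e M1 -> gr_lattice p e M2 ->
  ~ ordinary p M1 -> ~ ordinary p M2 ->
  connected_component (gr_space p r e F) (gr_point e F_F' M1)
    (gr_point e F_F' M2).
Proof.
move=> lat1 lat2 nord1 nord2.
have p_gt1 := prime_gt1 p_prime.
have r_gt1 : 1 < r.
  have := card_finNzRing_gt1 k; rewrite card_k.
  move: k_neq_Fp; rewrite card_k; case: (r) => [|[|]] //.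
have me : p.-1 * (e %/ p.-1) = e by rewrite mulnC divnK.
have m_gt0 : 0 < e %/ p.-1 by move: e_gt0; rewrite -{1}me muln_gt0 => /andP[].
have [s1 [G1 [s1m s1_gt0 G1s val1 ->]]] := nonordinary_std p_gt1 m_gt0 me lat1 nord1.
have [s2 [G2 [s2m s2_gt0 G2s val2 ->]]] := nonordinary_std p_gt1 m_gt0 me lat2 nord2.
(* A positive exponent s with 2s <= m forces m >= 2, so that the target exponent h is positive. *)
have m_gt1 : 1 < e %/ p.-1.
  pose i := Ordinal (ltnW r_gt1).
  by apply: leq_trans (s1m i); rewrite (leq_double 1) s1_gt0.
have joined1 := half_joined F_F' p_gt1 r_gt1 me m_gt1 s1m s1_gt0 G1s val1.
have joined2 := half_joined F_F' p_gt1 r_gt1 me m_gt1 s2m s2_gt0 G2s val2.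
exact: joined_trans joined1 (joined_sym joined2).
Qed.
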